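(* Let $T$ be a bounded linear operator on a complex Banach space $X$. The following are equivalent: (i) $T^n$ converges in operator norm as $n\to\infty$. (ii) $T$ is uniformly ergodic and $\sigma(T)\cap\mathbb T \subset\{1\}$. (iii) $T$ is rotationally uniformly ergodic and $\sigma(T)\cap\mathbb T \subset\{1\}$. (iv) $n^{-1}\|T^n\| \to 0$, and for each $x \in \overline{(I-T)X}$ the series $\sum_{n=1}^\infty \frac{\lambda^n T^n x}{n}$ converges in norm for every $\lambda \in\mathbb T$.
   Context: $\mathbb T$ is the unit circle in $\mathbb C$; $\sigma(T)$ is the spectrum of $T$. A bounded operator $S$ is uniformly ergodic if $\frac1n\sum_{k=1}^nS^k$ converges in operator norm. $T$ is rotationally uniformly ergodic if $\lambda T$ is uniformly ergodic for every $\lambda\in\mathbb T$. *)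

(* Defs.v *)
From HB Require Import structures.
From mathcomp Require Export all_boot all_order all_algebra.
From mathcomp Require Export all_classical all_reals all_analysis.
From mathcomp Require Export complex.

Set Implicit Arguments.
Unset Strict Implicit.
Unset Printing Implicit Defensive.

Import Order.TTheory GRing.Theory Num.Theory.
Import numFieldNormedType.Exports.

Local Open Scope classical_set_scope.
Local Open Scope complex_scope.
Local Open Scope ring_scope.

Section BoundedOperators.
Context {R : realType} {X : completeNormedModType R[i]}.
Implicit Types (S : X -> X) (T : {linear X -> X}) (U : nat -> X -> X).

Definition bounded_op S : Prop :=
  exists M : R, forall x : X, `|S x| <= M%:C * `|x|.

(* The norm of X takes its values in R[i], where it is real and nonnegative;
   complex.Re brings it back to R.  As sup is 0 on sets that are not bounded above,
   opnorm S is the operator norm only for a bounded linear S. *)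
Definition opnorm S : R :=
  sup [set complex.Re `|S x| | x in [set x : X | `|x| <= 1]].

(* Convergence of U in the space of bounded linear operators on X; the terms
   U n are meant to be bounded linear operators. *)
Definition op_cvg U : Prop :=
  exists P : {linear X -> X}, bounded_op P /\
    (opnorm (fun x => U n x - P x) @[n --> \oo] --> (0 : R)).

Definition uniformly_ergodic S : Prop :=
  op_cvg (fun n x => n%:R^-1 *: \sum_(1 <= k < n.+1) iter k S x).

Definition unit_circle : set R[i] := [set l | `|l| = 1].

Definition rotationally_uniformly_ergodic S : Prop :=
  forall l : R[i], unit_circle l -> uniformly_ergodic (fun x => l *: S x).

Definition spectrum T : set R[i] :=
  [set l | ~ exists S : {linear X -> X},
     [/\ bounded_op S,
         cancel (fun x => l *: x - T x) S &
         cancel S (fun x => l *: x - T x)]].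

End BoundedOperators.

Arguments unit_circle : clear implicits.

(* Main.v *)
From HB Require Import structures.
Require Import Defs.
From mathcomp Require Import all_boot all_order all_algebra.
From mathcomp Require Import all_classical all_reals all_analysis.
From mathcomp Require Import complex.
From mathcomp Require Import ring lra.

(** Everything rests on one estimate, [power_decay].  Let Y be a T-invariant
    subspace, let ||T^n|| grow at most linearly, and suppose that I - uT is
    bounded below on Y for every u in the unit circle.  Then
    (n+1) ||T^n x|| <= K ||x|| on Y.  By compactness the lower bounds have a
    common constant c, which still serves, doubled, when T is replaced by sT with
    s < 1 close to 1.  The partial sums of R(u) = sum_k (us)^k T^k x, and those of
    sum_k (k+1) (us)^k T^k x (which is R applied twice), then have norm at most
    2c ||x|| and 4c^2 ||x|| up to errors that vanish because s^n beats polynomial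
    growth.  A trigonometric polynomial that is bounded by b on the circle has
    coefficients bounded by b, so (k+1) s^k ||T^k x|| <= 4c^2 ||x||; finally s is
    chosen for each k so that s^k >= 1/2.  Only lower bounds on Y enter: no
    operator is inverted on Y.

    The first statement gives the second since Cesaro means follow the powers, and
    since for |l| = 1, l <> 1 and P the limit of T^n, the operator
    sum_(k < N) l^(-k-1) T^k (I - P) + P / (l - 1) inverts l - T up to an error of
    norm ||T^N - P|| ([power_limit_spectrum]); a Neumann series corrects it.

    From the second to the third, uniform ergodicity gives ||T^n|| / n -> 0, and
    for u <> 1 the sum of (uT)^k over 1 <= k <= n telescopes on the range of
    I - uT, which is everything ([rotated_ergodic]).

    From the third to the fourth, let P be the limit of the Cesaro means A_n.  On
    ker P the operator I - T is bounded below, since I - A_n is a multiple of it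
    and A_n is small there; the other points of the circle are handled by the
    spectral hypothesis.  Hence [power_decay] applies to ker P, which contains the
    closure of (I - T)X, and the logarithmic series is dominated by
    sum 1 / (n (n+1)).

    From the fourth to the first, uniform boundedness on the closure Y of (I - T)X
    bounds the partial sums H_N of sum u^n T^n / n uniformly.  On vectors almost
    fixed by uT, H_N is almost the N-th harmonic number, which is unbounded; so
    I - uT is bounded below on Y ([log_bounded_below]).  By [power_decay],
    T^n - T^(n+p) = T^n (I - T^p) is small, first making T power bounded and then
    making (T^n) Cauchy in norm ([op_cvg_of_decay]). *)

Import Order.TTheory GRing.Theory Num.Theory.
Import numFieldNormedType.Exports.

Local Open Scope classical_set_scope.
Local Open Scope complex_scope.
Local Open Scope ring_scope.

(** * Norms with real values *)
Section RealNorm.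
Context {R : realType}.

(** The norms at hand take values in R[i], which is only partially ordered; their
    real parts carry the same information in a totally ordered field. *)
Definition rnorm {V : normedZmodType R[i]} (x : V) : R := complex.Re `|x|.

Lemma ler_complex (a b : R) : (a%:C <= b%:C) = (a <= b).
Proof. by rewrite lecE /= eqxx. Qed.

Lemma ltr_complex (a b : R) : (a%:C < b%:C) = (a < b).
Proof. by rewrite ltcE /= eqxx. Qed.

Lemma gt0_complex_real (e : R[i]) : 0 < e -> exists2 a : R, e = a%:C & 0 < a.
Proof.
case: e => a b; rewrite ltcE /= => /andP[/eqP b0 a0].
by exists a => //; move: b0 => ->.
Qed.

Section Normed.
Context {V : normedZmodType R[i]}.
Implicit Types x y : V.

Lemma rnormE x : `|x| = (rnorm x)%:C.
Proof.
rewrite /rnorm; have := normr_ge0 x; move: `|x| => [a b].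
by rewrite lecE /= => /andP[/eqP -> _].
Qed.

Lemma rnorm_ge0 x : 0 <= rnorm x.
Proof. by rewrite -ler_complex -rnormE normr_ge0. Qed.

Lemma rnorm0 : rnorm (0 : V) = 0.
Proof. by rewrite /rnorm normr0. Qed.

Lemma rnorm_eq0 x : rnorm x = 0 -> x = 0.
Proof. by move=> h; apply/eqP; rewrite -normr_eq0 rnormE h. Qed.

Lemma rnormN x : rnorm (- x) = rnorm x.
Proof. by rewrite /rnorm normrN. Qed.

Lemma rnorm_sub x y : rnorm (x - y) = rnorm (y - x).
Proof. by rewrite /rnorm distrC. Qed.

Lemma ler_rnormD x y : rnorm (x + y) <= rnorm x + rnorm y.
Proof. by rewrite -ler_complex rmorphD /= -!rnormE ler_normD. Qed.

Lemma ler_rnormB x y : rnorm (x - y) <= rnorm x + rnorm y.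
Proof. by rewrite -[rnorm y]rnormN ler_rnormD. Qed.

Lemma ler_rnorm_sub x y : rnorm x <= rnorm (x - y) + rnorm y.
Proof. by rewrite -{1}(subrK y x) ler_rnormD. Qed.

End Normed.

Lemma rnormM (k l : R[i]) : rnorm (k * l) = rnorm k * rnorm l.
Proof.
by apply: complexI; rewrite rmorphM /= -!rnormE normrM.
Qed.

Lemma rnormX (k : R[i]) n : rnorm (k ^+ n) = rnorm k ^+ n.
Proof.
by apply: complexI; rewrite rmorphXn /= -!rnormE normrX.
Qed.

Lemma rnormV (k : R[i]) : rnorm k^-1 = (rnorm k)^-1.
Proof.
by apply: complexI; rewrite fmorphV /= -!rnormE normfV.
Qed.

Lemma rnorm_real (a : R) : rnorm a%:C = `|a|.
Proof. by rewrite /rnorm normc_def /= expr0n addr0 sqrtr_sqr. Qed.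

Lemma rnorm_nat n : rnorm (n%:R : R[i]) = n%:R.
Proof. by rewrite /rnorm normr_nat -(rmorph_nat (real_complex R)). Qed.

Lemma rnorm_circle (u : R[i]) : unit_circle R u <-> rnorm u = 1.
Proof.
rewrite /unit_circle /= rnormE; split => [h|->//].
exact: complexI.
Qed.

Context {X : completeNormedModType R[i]}.
Implicit Types x y : X.

Lemma rnormZ (k : R[i]) x : rnorm (k *: x) = rnorm k * rnorm x.
Proof. by apply: complexI; rewrite rmorphM /= -!rnormE normrZ. Qed.

Lemma rnorm_cvgP (u : nat -> X) (l : X) :
  (u n @[n --> \oo] --> l) <->
  forall e : R, 0 < e ->
    exists N, forall n, (N <= n)%N -> rnorm (u n - l) < e.
Proof.
split=> [/cvgrPdist_lt h e e0|h].
  have : 0 < e%:C by rewrite (ltr_complex 0).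
  move=> /h[N _ hN]; exists N => n /hN /=.
  by rewrite rnormE ltr_complex rnorm_sub.
apply/cvgrPdist_lt => e /gt0_complex_real[a -> /h[N hN]].
by exists N => // n /hN /=; rewrite rnormE ltr_complex rnorm_sub.
Qed.

Lemma rnorm_cauchy_cvg (u : nat -> X) :
  (forall e : R, 0 < e -> exists N, forall n m,
    (N <= n)%N -> (n <= m)%N -> rnorm (u m - u n) < e) ->
  exists l : X, u n @[n --> \oo] --> l.
Proof.
move=> h; apply/cvg_ex; apply/cauchy_cvgP/cauchy_ballP.
move=> _ /gt0_complex_real[a -> a0].
have [|N hN] := h (a / 2); first by rewrite divr_gt0.
exists (ball (u N) (a / 2)%:C, ball (u N) (a / 2)%:C).
  by split; exists N => // n hn /=; rewrite -ball_normE /= rnormE ltr_complex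
    rnorm_sub; exact: hN.
move=> [x y] [/= hx hy]; rewrite (splitr a) rmorphD /=.
by apply: ball_triangle hy; exact: ball_sym.
Qed.

Lemma rnorm_closureP (A : set X) x :
  closure A x <-> forall e : R, 0 < e -> exists2 y, A y & rnorm (x - y) < e.
Proof.
split=> [h e e0|h B /nbhs_ballP[_ /gt0_complex_real[a -> a0] hB]].
  have e0' : 0 < e%:C by rewrite (ltr_complex 0).
  have [y [Ay]] := h _ (nbhsx_ballx x _ e0').
  by rewrite -ball_normE /= rnormE ltr_complex; exists y.
have [y Ay hy] := h _ a0; exists y; split=> //; apply: hB.
by rewrite -ball_normE /= rnormE ltr_complex.
Qed.

Lemma rnorm_cvg_le (u : nat -> X) (l x : X) (c : R) N :
  (u n @[n --> \oo] --> l) ->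
  (forall n, (N <= n)%N -> rnorm (u n - x) <= c) -> rnorm (l - x) <= c.
Proof.
move=> /rnorm_cvgP hl h; apply/ler_addgt0Pr => e e0.
have [M hM] := hl _ e0.
have h1 := h _ (leq_maxl N M); have h2 := hM _ (leq_maxr N M).
have h3 := ler_rnormD (l - u (maxn N M)) (u (maxn N M) - x).
rewrite rnorm_sub in h2; rewrite subrKA in h3; lra.
Qed.

Lemma rnorm_cvg_unique (u : nat -> X) (a b : X) :
  (u n @[n --> \oo] --> a) -> (u n @[n --> \oo] --> b) -> a = b.
Proof. by move=> ha hb; exact: (cvg_unique _ ha hb). Qed.

End RealNorm.

(** * Operator norm estimates and limits of operators *)
Section OperatorNorm.
Context {R : realType} {X : completeNormedModType R[i]}.
Implicit Types (f : X -> X) (c : R).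

(** Pointwise bounds compose and add up directly, without the supremum of
    [opnorm]; the two are exchanged by [opnorm_le] and [le_opnorm]. *)
Definition op_le f c := forall x, rnorm (f x) <= c * rnorm x.

Lemma op_leW f c d : c <= d -> op_le f c -> op_le f d.
Proof.
by move=> cd h x; apply: le_trans (h x) _; rewrite ler_wpM2r// rnorm_ge0.
Qed.

Lemma op_le_comp f g c d : 0 <= c -> op_le f c -> op_le g d ->
  op_le (fun x => f (g x)) (c * d).
Proof.
by move=> c0 hf hg x; apply: le_trans (hf _) _; rewrite -mulrA ler_wpM2l.
Qed.

Lemma op_leD f g c d : op_le f c -> op_le g d ->
  op_le (fun x => f x + g x) (c + d).
Proof.
by move=> hf hg x; apply: le_trans (ler_rnormD _ _) _; rewrite mulrDl lerD.
Qed.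

Lemma op_leB f g c d : op_le f c -> op_le g d ->
  op_le (fun x => f x - g x) (c + d).
Proof.
by move=> hf hg x; apply: le_trans (ler_rnormB _ _) _; rewrite mulrDl lerD.
Qed.

Lemma op_leZ (k : R[i]) f c : op_le f c ->
  op_le (fun x => k *: f x) (rnorm k * c).
Proof.
by move=> hf x; rewrite rnormZ -mulrA ler_wpM2l// rnorm_ge0.
Qed.

Lemma op_le_id : op_le id 1.
Proof. by move=> x; rewrite mul1r. Qed.

Lemma op_le_iter f c n : 0 <= c -> op_le f c -> op_le (iter n f) (c ^+ n).
Proof.
move=> c0 hf; elim: n => [|n IH]; first by rewrite expr0; exact: op_le_id.
by rewrite exprS; exact: op_le_comp.
Qed.

Lemma bounded_opP f : bounded_op f <-> exists2 c, 0 <= c & op_le f c.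
Proof.
split=> [[M h]|[c _ h]]; last first.
  exists c => x; rewrite !rnormE -rmorphM /= ler_complex; exact: h.
exists (Num.max 0 M); first by rewrite le_max lexx.
apply: (@op_leW _ M); first by rewrite le_max lexx orbT.
by move=> x; have := h x; rewrite !rnormE -rmorphM /= ler_complex.
Qed.

Lemma unit_ballE (x : X) : (`|x| <= 1) = (rnorm x <= 1).
Proof. by rewrite rnormE (ler_complex _ 1). Qed.

Lemma opnorm_le f c : 0 <= c -> op_le f c -> opnorm f <= c.
Proof.
move=> c0 h; apply: ge_sup.
  by exists (rnorm (f 0)); exists 0 => //=; rewrite normr0.
move=> _ [x /= + <-]; rewrite unit_ballE => x1.
by apply: le_trans (h x) _; rewrite -[leRHS]mulr1 ler_wpM2l.
Qed.

Lemma opnorm_ge0 f : 0 <= opnorm f.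
Proof.
rewrite /opnorm; set A := [set _ | _ in _].
have [hA|/sup_out->//] := pselect (has_sup A).
apply: le_trans (rnorm_ge0 (f 0)) _; apply: sup_upper_bound => //.
by exists 0 => //=; rewrite normr0.
Qed.

Lemma le_opnorm (f : {linear X -> X}) c : op_le f c -> op_le f (opnorm f).
Proof.
move=> h x; have [x0|x0] := eqVneq (rnorm x) 0.
  by rewrite (rnorm_eq0 _ x0) linear0 rnorm0 mulr0.
have xp : 0 < rnorm x by rewrite lt_neqAle eq_sym x0 rnorm_ge0.
rewrite -ler_pdivrMr//.
have r1 : rnorm (((rnorm x)^-1)%:C : R[i]) = (rnorm x)^-1.
  by rewrite rnorm_real ger0_norm// invr_ge0 ltW.
have -> : rnorm (f x) / rnorm x = rnorm (f (((rnorm x)^-1)%:C *: x)).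
  by rewrite linearZ rnormZ r1 mulrC.
have c0 : 0 <= c by rewrite -(pmulr_lge0 _ xp); exact: le_trans (rnorm_ge0 _) (h x).
apply: sup_upper_bound; last first.
  by exists (((rnorm x)^-1)%:C *: x) => //=; rewrite unit_ballE rnormZ r1 mulVf.
split; first by exists (rnorm (f 0)); exists 0 => //=; rewrite normr0.
exists c => _ [y /= + <-]; rewrite unit_ballE => y1.
by apply: le_trans (h y) _; rewrite -[leRHS]mulr1 ler_wpM2l.
Qed.

Definition linear_pack f (hf : linear f) : {linear X -> X} :=
  HB.pack f (GRing.isLinear.Build R[i] X X *:%R f hf).

Lemma linear_iter (T : {linear X -> X}) n : linear (iter n T).
Proof. by move=> a x y; elim: n => //= n ->; rewrite linearP. Qed.

Lemma linear_iterB (T : {linear X -> X}) n x y :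
  iter n T (x - y) = iter n T x - iter n T y.
Proof. exact: (linearB (linear_pack _ (linear_iter T n))). Qed.

(** Replaces the convergence of [opnorm] to 0 by uniform pointwise bounds, the only
    form in which operator limits are used below. *)
Lemma op_cvgP (U : nat -> {linear X -> X}) :
  (forall n, exists c, op_le (U n) c) ->
  op_cvg (fun n => U n) <->
  exists P : {linear X -> X}, bounded_op P /\
    forall e, 0 < e ->
      exists N, forall n, (N <= n)%N -> op_le (fun x => U n x - P x) e.
Proof.
move=> hU; split=> -[P [hP h]]; exists P; split=> //.
  move=> e e0; have /cvgrPdist_lt/(_ _ e0)[N _ hN] := h.
  exists N => n /hN /=; rewrite sub0r normrN ger0_norm ?opnorm_ge0// => he.
  apply: op_leW (ltW he) _.
  have lin : linear (fun x => U n x - P x).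
    by move=> a x y; rewrite (linearP (U n)) (linearP P) scalerBr opprD addrACA.
  have [c hc] := hU n; have /bounded_opP[d _ hd] := hP.
  exact: (le_opnorm (linear_pack _ lin) (c + d) (op_leB _ _ _ _ hc hd)).
apply/cvgrPdist_le => e e0; have [N hN] := h _ e0.
exists N => // n /hN hn /=; rewrite sub0r normrN ger0_norm ?opnorm_ge0//.
exact: opnorm_le (ltW e0) hn.
Qed.

(** Completeness of the space of bounded operators: the pointwise limit exists
    because X is complete, and the uniform Cauchy bounds pass to it. *)
Lemma cauchy_op_cvg (U : nat -> {linear X -> X}) :
  (forall n, exists c, op_le (U n) c) ->
  (forall e, 0 < e -> exists N, forall n m, (N <= n)%N -> (n <= m)%N ->
     op_le (fun x => U m x - U n x) e) ->
  exists P : {linear X -> X}, [/\ bounded_op P,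
    forall x, U n x @[n --> \oo] --> P x &
    forall e, 0 < e ->
      exists N, forall n, (N <= n)%N -> op_le (fun x => U n x - P x) e].
Proof.
move=> hU hC.
have hx x : exists l : X, U n x @[n --> \oo] --> l.
  apply: (rnorm_cauchy_cvg (fun n => U n x)) => e e0.
  have x1 : 0 < rnorm x + 1 by rewrite ltr_wpDl// rnorm_ge0.
  have [|N hN] := hC (e / (rnorm x + 1)); first by rewrite divr_gt0.
  exists N => n m hn hm; apply: le_lt_trans (hN _ _ hn hm x) _.
  by rewrite mulrAC ltr_pdivrMr // ltr_pM2l// ltrDl.
pose P x := projT1 (cid (hx x)).
have cP x : U n x @[n --> \oo] --> P x := projT2 (cid (hx x)).
have lin : linear P.
  move=> a x y; apply: rnorm_cvg_unique (cP _) _.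
  under eq_fun => n do rewrite (linearP (U n)).
  by apply: cvgD (cP y); apply: cvgZr.
have hlim e : 0 < e ->
    exists N, forall n, (N <= n)%N -> op_le (fun x => U n x - P x) e.
  move=> e0; have [N hN] := hC _ e0; exists N => n hn x.
  rewrite rnorm_sub; apply: (rnorm_cvg_le _ _ _ _ n (cP x)) => m hm.
  exact: hN.
exists (linear_pack P lin); split=> //.
apply/bounded_opP; have [N hN] := hlim _ ltr01; have [c hc] := hU N.
exists (`|c| + 1); first by rewrite addr_ge0.
move=> x; have := op_leB _ _ _ _ hc (hN _ (leqnn N)) x; rewrite subKr.
move=> /le_trans; apply; rewrite ler_wpM2r ?rnorm_ge0// lerD2r.
exact: ler_norm.
Qed.

End OperatorNorm.

(** * Elementary real inequalities *)
Section RealSequences.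
Context {R : realType}.
Implicit Types (a b e r : R).

Lemma bernoulli_le d n : 0 <= d -> d <= 1 -> 1 - n%:R * d <= (1 - d : R) ^+ n.
Proof.
move=> d0 d1; elim: n => [|n IH]; first by rewrite mul0r subr0.
have d1' : 0 <= 1 - d by lra.
have /= := ler_wpM2l d1' IH; rewrite -exprS => /(le_trans _); apply.
rewrite -natr1; have n0 : 0 <= n%:R * (d * d) by rewrite !mulr_ge0.
lra.
Qed.

(** The n+1 terms r^k with k <= n are all at least r^n, and their sum is at most
    1 / (1 - r). *)
Lemma geometric_decay r n : 0 <= r -> r < 1 -> n.+1%:R * r ^+ n <= (1 - r)^-1.
Proof.
move=> r0 r1; have d0 : 0 < 1 - r by lra.
rewrite -[leRHS]mul1r ler_pdivlMr//.
apply: (@le_trans _ _ (1 - r ^+ n.+1)); last by rewrite gerBl exprn_ge0.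
elim: n => [|n IH]; first by rewrite expr0 expr1 mulr1 mul1r.
have h1 := ler_wpM2l r0 IH.
have h2 : r ^+ n.+1 * (1 - r) <= 1 - r.
  by rewrite ger_pMl// exprn_ile1// ltW.
rewrite -natr1 [r ^+ n.+2]exprS; rewrite exprS in h1 h2 *.
set A := r ^+ n in h1 h2 *; set N := n.+1%:R in h1 *; lra.
Qed.

Lemma nat_large r : exists N, forall n, (N <= n)%N -> r < n.+1%:R.
Proof.
exists (Num.truncn r) => n hn; apply: lt_le_trans (truncnS_gt r) _.
by rewrite ler_nat ltnS.
Qed.

Lemma le_of_harmonic_error N a b e :
  (forall n, (N <= n)%N -> a <= b + e / n.+1%:R) -> a <= b.
Proof.
move=> h; rewrite leNgt; apply/negP => ba.
have [M hM] := nat_large (e / (a - b)).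
have := h (maxn N M) (leq_maxl _ _); have := hM (maxn N M) (leq_maxr _ _).
rewrite ltr_pdivrMr ?subr_gt0// -lerBlDl ler_pdivlMr ?ltr0Sn// => h1 h2.
by move: h1; rewrite mulrC ltNge h2.
Qed.

End RealSequences.

(** * Coefficients of trigonometric polynomials *)
Section CoefficientEstimate.
Context {R : realType} {X : completeNormedModType R[i]}.

Lemma sum_even_odd (V : nmodType) (f : nat -> V) n :
  \sum_(k < n.*2) f k = \sum_(k < n) f k.*2 + \sum_(k < n) f k.*2.+1.
Proof.
elim: n => [|n IH]; first by rewrite !big_ord0 addr0.
by rewrite doubleS !big_ord_recr /= IH !addrA; congr (_ + _); rewrite addrAC.
Qed.

Lemma rnorm_le_of_addsub (x y : X) (b : R) :
  rnorm (x + y) <= b -> rnorm (x - y) <= b -> rnorm x <= b.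
Proof.
move=> h1 h2.
have : rnorm (2%:R *: x) <= b + b.
  rewrite scaler_nat mulr2n -[X in X + _](addrK y x) -addrA [- y + x]addrC.
  by apply: le_trans (ler_rnormD _ _) _; exact: lerD.
rewrite rnormZ rnorm_nat; lra.
Qed.

(** A coefficient is an average of u^(-j) p(u) over the circle.  Averaging over u
    and -u only, and repeating, uses square roots instead of an integral or of
    primitive roots of unity; lengths are powers of 2 for that reason. *)
Lemma coefficient_le (m : nat) (a : nat -> X) (b : R) :
  (forall u : R[i], rnorm u = 1 -> rnorm (\sum_(k < 2 ^ m) u ^+ k *: a k) <= b) ->
  forall j, (j < 2 ^ m)%N -> rnorm (a j) <= b.
Proof.
elim: m a => [|m IH] a h j hj.
  have := h 1; rewrite expn0 big_ord_recl big_ord0 addr0 expr0 scale1r.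
  move: hj; rewrite expn0 ltnS leqn0 => /eqP -> /=; apply.
  by rewrite (rnorm_real 1) normr1.
have key (u : R[i]) : rnorm u = 1 ->
    rnorm (\sum_(k < 2 ^ m) u ^+ k *: a k.*2) <= b /\
    rnorm (\sum_(k < 2 ^ m) u ^+ k *: a k.*2.+1) <= b.
  (* With v^2 = u, the values at v and -v are E + vO and E - vO, where E and O
     are the even and odd parts, half as long, evaluated at u. *)
  move=> u1; pose v := sqrtC u.
  have vu : v ^+ 2 = u by rewrite sqrtCK.
  have v1 : rnorm v = 1.
    apply/eqP; rewrite -(@eqrXn2 _ 2)// ?rnorm_ge0//.
    by rewrite -rnormX vu u1 expr1n.
  set E := \sum_(k < _) _ *: a _.*2; set O := \sum_(k < _) _.
  have split_sum (w : R[i]) : w ^+ 2 = u ->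
      \sum_(k < 2 ^ m.+1) w ^+ k *: a k = E + w *: O.
    move=> wu; rewrite expnS mul2n (sum_even_odd _ (fun k => w ^+ k *: a k)).
    congr (_ + _); last rewrite scaler_sumr; apply: eq_bigr => k _.
      by rewrite -mul2n exprM wu.
    by rewrite exprS -mul2n exprM wu scalerA.
  have hp := h v v1; rewrite split_sum// in hp.
  have := h (- v); rewrite split_sum ?sqrrN// rnormN scaleNr => /(_ v1) hm.
  split; first exact: rnorm_le_of_addsub hp hm.
  have -> : rnorm O = rnorm (v *: O) by rewrite rnormZ v1 mul1r.
  by apply: (rnorm_le_of_addsub _ E); rewrite ?[_ + E]addrC// rnorm_sub.
have jd := odd_double_half j.
have hj2 : (j./2 < 2 ^ m)%N.
  by rewrite -ltn_double -[(2 ^ m).*2]mul2n -expnS; apply: leq_ltn_trans hj;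
    rewrite -[leqRHS]jd leq_addl.
rewrite -jd; case: (odd j); rewrite ?add1n ?add0n.
  apply: (IH (fun k => a k.*2.+1)) => // u /key[]//.
by apply: (IH (fun k => a k.*2)) => // u /key[].
Qed.

End CoefficientEstimate.

(** * Lower bounds, uniformly over the unit circle *)
Section Circle.
Context {R : realType}.

Lemma circle_compact :
  compact [set p : R * R | p.1 ^+ 2 + p.2 ^+ 2 = 1].
Proof.
apply: (@subclosed_compact _ _ (`[(-1 : R), 1]%classic `*` `[(-1 : R), 1]%classic)).
- apply: (@closed_comp _ _ (fun p : R * R => p.1 ^+ 2 + p.2 ^+ 2) [set 1]).
    move=> p _; apply: cvgD; rewrite expr2; apply: cvgM;
      by [exact: cvg_fst|exact: cvg_snd].
  exact: closed_eq.
- by apply: compact_setX; exact: segment_compact.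
- move=> [a b] /= h; rewrite !in_itv /=; split; apply/andP; split; nra.
Qed.

End Circle.

Section LowerBounds.
Context {R : realType} {X : completeNormedModType R[i]}.
Variables (T : {linear X -> X}) (t : R) (Y : set X).
Hypotheses (t0 : 0 <= t) (Tt : op_le T t).

Definition bounded_below_on (u : R[i]) (c : R) :=
  forall x, Y x -> rnorm x <= c * rnorm (x - u *: T x).

(** A perturbation of I - uT of norm at most 1 / (2c) costs a factor 2. *)
Lemma bounded_below_near u v c : bounded_below_on u c -> 0 <= c ->
  c * (rnorm (u - v) * t) <= 2^-1 -> bounded_below_on v (2 * c).
Proof.
move=> h c0 hc x Yx; have h1 := h x Yx.
have h2 : rnorm (x - u *: T x) <=
    rnorm (x - v *: T x) + rnorm (u - v) * t * rnorm x.
  have -> : x - u *: T x = (x - v *: T x) - (u - v) *: T x.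
    by rewrite scalerBl opprB subrKA.
  apply: le_trans (ler_rnormB _ _) _; rewrite lerD2l rnormZ -mulrA.
  by rewrite ler_wpM2l// rnorm_ge0.
have h3 := ler_wpM2l c0 h2; have h4 := ler_wpM2r (rnorm_ge0 x) hc.
lra.
Qed.

(** A lower bound at one point of the circle persists nearby by
    [bounded_below_near]; compactness makes the constant uniform. *)
Lemma bounded_below_uniform :
  (forall u, rnorm u = 1 -> exists c, bounded_below_on u c) ->
  exists2 c, 0 <= c & forall u, rnorm u = 1 -> bounded_below_on u c.
Proof.
move=> h.
pose K := [set p : R * R | p.1 ^+ 2 + p.2 ^+ 2 = 1].
pose z (p : R * R) : R[i] := p.1 +i* p.2.
have hK p : K p -> rnorm (z p) = 1.
  by move=> Kp; rewrite /rnorm normc_def /= Kp sqrtr1.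
have/compact_near_coveringP cov := @circle_compact R.
have [|N _ hN] := cov nat \oo
    (fun n p => K p -> bounded_below_on (z p) n%:R) _; last first.
  exists N%:R => // -[a b] u1.
  suff Kab : K (a, b) by apply: (hN N _ (a, b)) => /=.
  move: u1; rewrite /rnorm normc_def /= => /(congr1 (fun r => r ^+ 2)).
  by rewrite sqr_sqrtr ?expr1n// addr_ge0 ?sqr_ge0.
move=> p Kp; have [c0 hc0] := h _ (hK _ Kp).
pose c := Num.max 0 c0.
have c_ge0 : 0 <= c by rewrite le_max lexx.
have hc : bounded_below_on (z p) c.
  move=> x /hc0 /le_trans; apply; rewrite ler_wpM2r ?rnorm_ge0//.
  by rewrite le_max lexx orbT.
(* On a square of half-side d around p the parameter moves by at most 2d, so that
   c (2d) t <= 1/2. *)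
pose d := (4 * (c * t + 1))^-1.
have ct0 : 0 <= c * t by rewrite mulr_ge0.
have d0 : 0 < d by rewrite invr_gt0; lra.
have [M hM] := nat_large (2 * c).
exists (ball p d, [set n | (M.+1 <= n)%N]); first split.
- exact: nbhsx_ballx.
- by exists M.+1.
move=> [q n] [/= [h1 h2] hn] Kq.
move: n hn => [//|n]; rewrite ltnS => hn.
have hd : rnorm (z p - z q) <= 2 * d.
  have -> : z p - z q = (p.1 - q.1)%:C + 'i * (p.2 - q.2)%:C.
    rewrite /z; case: p q {Kp hc0 hc h1 h2 Kq} => [a b] [a' b'].
    by simpc.
  apply: le_trans (ler_rnormD _ _) _; rewrite rnormM !rnorm_real.
  have -> : rnorm ('i : R[i]) = 1.
    by rewrite /rnorm normc_def /= expr0n add0r expr1n sqrtr1.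
  move: h1 h2; rewrite /ball /= => h1 h2; lra.
have : bounded_below_on (z q) (2 * c).
  apply: (bounded_below_near _ _ _ hc c_ge0).
  have e4 : 4 * (c * t + 1) * d = 1 by rewrite mulfV// gt_eqF//; lra.
  have := ler_wpM2l ct0 hd; nra.
move=> hq x /hq /le_trans; apply; rewrite ler_wpM2r ?rnorm_ge0//.
exact: ltW (hM _ hn).
Qed.

End LowerBounds.

(** * Decay of powers *)
Section Decay.
Context {R : realType} {X : completeNormedModType R[i]}.
Variables (T : {linear X -> X}) (t : R) (Y : set X).
Hypotheses (t0 : 0 <= t) (Tt : op_le T t).
Hypotheses (Y0 : Y 0) (YP : forall a x y, Y x -> Y y -> Y (a *: x + y)).
Hypothesis YT : forall x, Y x -> Y (T x).

Lemma invariant_iter n x : Y x -> Y (iter n T x).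
Proof. by move=> Yx; elim: n => //= n; exact: YT. Qed.

Lemma invariant_sum (w : nat -> R[i]) n x :
  Y x -> Y (\sum_(k < n) w k *: iter k T x).
Proof.
move=> Yx; elim: n => [|n IH]; first by rewrite big_ord0.
by rewrite big_ord_recr /= addrC; apply: YP => //; exact: invariant_iter.
Qed.

Lemma geometric_telescope (q : R[i]) n x :
  let G := \sum_(k < n) q ^+ k *: iter k T x in
  G - q *: T G = x - q ^+ n *: iter n T x.
Proof.
elim: n => [|n IH] /=.
  by rewrite !big_ord0 linear0 scaler0 subr0 expr0 scale1r subrr.
rewrite !big_ord_recr /= (linearD T) scalerDr opprD addrACA IH (linearZZ T) scalerA.
by rewrite -exprS subrKA.
Qed.

Lemma weighted_geometric_telescope (q : R[i]) n x :
  let L := \sum_(k < n) (k.+1%:R * q ^+ k) *: iter k T x in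
  L - q *: T L =
    \sum_(k < n) q ^+ k *: iter k T x - (n%:R * q ^+ n) *: iter n T x.
Proof.
elim: n => [|n IH] /=.
  by rewrite !big_ord0 linear0 scaler0 subr0 mul0r scale0r subr0.
rewrite !big_ord_recr /= (linearD T) scalerDr opprD addrACA IH (linearZZ T) scalerA.
rewrite mulrCA -exprS [RHS]addrAC -[RHS]addrA -!addrA; congr (_ + _).
rewrite [RHS]addrC -natr1 mulrDl mul1r scalerDl.
by rewrite -!addrA addKr.
Qed.

(** The estimate for T damped by s = p^3.  With
    G = sum_(k < N) q^k T^k x and L = sum_(k < N) (k+1) q^k T^k x, where q = su,
    the vectors (I - qT) G and (I - qT) L are x and G up to multiples of
    q^N T^N x, so two lower bounds give ||L|| <= c^2 ||x|| plus an error that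
    vanishes as N grows; then [coefficient_le] isolates the terms of L. *)
Lemma weighted_power_le (c p D : R) (j : nat) x :
  0 <= c -> 0 <= p -> p < 1 -> 0 <= D ->
  (forall u, rnorm u = 1 -> bounded_below_on T Y ((p ^+ 3)%:C * u) c) ->
  (forall n, op_le (iter n T) (D * n.+1%:R)) ->
  Y x ->
  j.+1%:R * (p ^+ 3) ^+ j * rnorm (iter j T x) <= c ^+ 2 * rnorm x.
Proof.
move=> c0 p0 p1 D0 hb hD Yx.
have s0 : 0 <= p ^+ 3 by rewrite exprn_ge0.
have [s sE] : exists s, s = p ^+ 3 by exists (p ^+ 3).
rewrite -sE in hb s0 *.
apply: (@le_of_harmonic_error _ j _ _
  ((c ^+ 2 + c) * D * ((1 - p)^-1) ^+ 3 * rnorm x)) => m hm.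
(* The truncation order is a power of 2 to suit coefficient_le; the error of
   truncation is at most a constant over N + 1, hence over m + 1. *)
pose N := (2 ^ m)%N; have mN : (m < N)%N by exact: ltn_expl.
pose e := s ^+ N * rnorm (iter N T x).
have key (u : R[i]) : rnorm u = 1 ->
    rnorm (\sum_(k < N) u ^+ k *: (k.+1%:R * (s ^+ k)%:C *: iter k T x)) <=
    c ^+ 2 * rnorm x + (c ^+ 2 + c) * (N.+1%:R * e).
  move=> u1; pose q := s%:C * u.
  have hq := hb _ u1.
  have sq : rnorm (q ^+ N) = s ^+ N.
    by rewrite rnormX rnormM u1 rnorm_real mulr1 ger0_norm.
  have -> : \sum_(k < N) u ^+ k *: (k.+1%:R * (s ^+ k)%:C *: iter k T x) =
            \sum_(k < N) (k.+1%:R * q ^+ k) *: iter k T x.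
    apply: eq_bigr => k _; rewrite scalerA /q exprMn rmorphXn /=.
    by congr (_ *: _); rewrite mulrCA [_ * u ^+ k]mulrC.
  have hG := hq _ (invariant_sum (fun k => q ^+ k) N _ Yx).
  have hL := hq _ (invariant_sum (fun k => k.+1%:R * q ^+ k) N _ Yx).
  rewrite geometric_telescope in hG; rewrite weighted_geometric_telescope in hL.
  have hG' := le_trans hG (ler_wpM2l c0 (ler_rnormB _ _)).
  have hL' := le_trans hL (ler_wpM2l c0 (ler_rnormB _ _)).
  rewrite !rnormZ sq in hG'; rewrite rnormZ rnormM sq rnorm_nat -mulrA in hL'.
  rewrite -/e in hG' hL'.
  apply: le_trans hL' _.
  have h1 := ler_wpM2l c0 hG'.
  have e0 : 0 <= e by rewrite mulr_ge0 ?exprn_ge0 ?rnorm_ge0.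
  have : 0 <= c * c * e * N%:R by do 3!apply: mulr_ge0 => //.
  have : 0 <= c * e by exact: mulr_ge0.
  rewrite -natr1; lra.
have jN : (j < N)%N by exact: leq_ltn_trans hm mN.
have := coefficient_le m (fun k => (k.+1%:R * (s ^+ k)%:C) *: iter k T x)
  _ key j jN.
rewrite rnormZ rnormM rnorm_nat rnorm_real ger0_norm ?exprn_ge0//.
move=> /le_trans; apply; rewrite lerD2l.
have N0 : 0 < N.+1%:R :> R by rewrite ltr0Sn.
(* s^N is a cube, and one factor p^N absorbs each factor N + 1: two come from
   the weights and from the growth of
   the powers, and the third yields the decay in N. *)
have final : N.+1%:R * e <= D * ((1 - p)^-1 ^+ 3 / m.+1%:R * rnorm x).
  have hN : e <= s ^+ N * (D * N.+1%:R * rnorm x).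
    by rewrite ler_wpM2l ?exprn_ge0//; exact: hD.
  apply: le_trans (ler_wpM2l (ltW N0) hN) _.
  have -> : N.+1%:R * (s ^+ N * (D * N.+1%:R * rnorm x)) =
      D * (((N.+1%:R * p ^+ N) ^+ 3 / N.+1%:R) * rnorm x).
    have -> : s ^+ N = (p ^+ N) ^+ 3 by rewrite sE -!exprM mulnC.
    by field; rewrite gt_eqF.
  rewrite ler_wpM2l// ler_wpM2r ?rnorm_ge0// ler_pM ?divr_ge0 ?invr_ge0//.
  - by rewrite exprn_ge0// mulr_ge0 ?exprn_ge0.
  - rewrite lerXn2r// ?nnegrE ?mulr_ge0 ?exprn_ge0 ?invr_ge0 ?subr_ge0//.
      exact: ltW.
    exact: geometric_decay.
  - by rewrite lef_pV2 ?posrE ?ltr0Sn// ler_nat ltnS ltnW.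
have cc : 0 <= c ^+ 2 + c by rewrite addr_ge0 ?exprn_ge0.
apply: le_trans (ler_wpM2l cc final) _.
rewrite le_eqVlt; apply/orP; left; apply/eqP; ring.
Qed.

(** Applying the resolvent twice puts the factor n+1 in front of T^n, and this is
    what turns boundedness of the resolvent into decay of the powers. *)
Lemma power_decay (D : R) :
  0 <= D -> (forall n, op_le (iter n T) (D * n.+1%:R)) ->
  (forall u, rnorm u = 1 -> exists c, bounded_below_on T Y u c) ->
  exists2 K, 0 <= K & forall n x, Y x ->
    n.+1%:R * rnorm (iter n T x) <= K * rnorm x.
Proof.
move=> D0 hD /(bounded_below_uniform _ _ _ t0 Tt)[c c0 hc].
exists (8 * c ^+ 2); first by rewrite mulr_ge0 ?exprn_ge0.
move=> j x Yx.
(* The damping s = (1 - d)^3 is chosen for each j: 6cdt <= 1 keeps the lower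
   bounds at the price of doubling c, and 6dj <= 1 gives s^j >= 1/2. *)
pose d : R := (2 + 6 * j%:R + 6 * (c * t))^-1.
have ct0 : 0 <= c * t by rewrite mulr_ge0.
have j0 : 0 <= j%:R :> R by [].
have den : 0 < 2 + 6 * j%:R + 6 * (c * t) by lra.
have d0 : 0 < d by rewrite invr_gt0.
have dE : 2 * d + 6 * (j%:R * d) + 6 * (c * t * d) = 1.
  by have := mulfV (lt0r_neq0 den); rewrite -/d; lra.
have jd0 : 0 <= j%:R * d by rewrite mulr_ge0// ltW.
have cd0 : 0 <= c * t * d by rewrite mulr_ge0// ltW.
have d1 : d <= 1 by lra.
have p0 : 0 <= 1 - d by lra.
have p1 : 1 - d < 1 by lra.
have B3 := bernoulli_le d 3 (ltW d0) d1.
have hb (u : R[i]) : rnorm u = 1 ->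
    bounded_below_on T Y (((1 - d) ^+ 3)%:C * u) (2 * c).
  move=> u1; apply: (bounded_below_near _ t _ Tt u _ _ (hc _ u1) c0).
  rewrite -{1}[u]mul1r -mulrBl rnormM u1 mulr1.
  have -> : 1 - ((1 - d) ^+ 3)%:C = (1 - (1 - d) ^+ 3)%:C by rewrite rmorphB.
  rewrite rnorm_real ger0_norm; last by rewrite subr_ge0 exprn_ile1// ltW.
  have h : c * t * (1 - (1 - d) ^+ 3) <= c * t * (3 * d).
    by rewrite ler_wpM2l//; lra.
  lra.
have c20 : 0 <= 2 * c by lra.
have := weighted_power_le _ _ _ j _ c20 p0 p1 D0 hb hD Yx.
have Bj := bernoulli_le d (3 * j) (ltW d0) d1.
rewrite -exprM; set q := (1 - d) ^+ (3 * j) in Bj *.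
have q2 : 2^-1 <= q by move: Bj; rewrite natrM; lra.
have a0 : 0 <= j.+1%:R * rnorm (iter j T x) by rewrite mulr_ge0 ?rnorm_ge0.
have half := ler_wpM2l a0 q2; move=> bound.
have : j.+1%:R * rnorm (iter j T x) * 2^-1 <= (2 * c) ^+ 2 * rnorm x.
  by apply: le_trans half _; rewrite mulrAC.
rewrite ler_pdivrMr// => /le_trans; apply.
by rewrite le_eqVlt; apply/orP; left; apply/eqP; ring.
Qed.

End Decay.

(** * Bounded sequences and the harmonic series *)
Section BoundedSequences.
Context {R : realType}.

Lemma bounded_initial (a : nat -> R) N :
  exists2 b, 0 <= b & forall n, (n < N)%N -> a n <= b.
Proof.
exists (\sum_(k < N) `|a k|); first by rewrite sumr_ge0.
move=> n hn; rewrite (bigD1 (Ordinal hn))//=; apply: le_trans (ler_norm _) _.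
by rewrite lerDl sumr_ge0.
Qed.

Lemma bounded_of_eventually (a : nat -> R) N c :
  (forall n, (N <= n)%N -> a n <= c) ->
  exists2 b, 0 <= b & forall n, a n <= b.
Proof.
move=> h; have [b b0 hb] := bounded_initial a N.
exists (b + `|c|); first by rewrite addr_ge0.
move=> n; have [nN|Nn] := ltnP n N.
  by apply: le_trans (hb _ nN) _; rewrite lerDl.
apply: le_trans (h _ Nn) _; apply: le_trans (ler_norm _) _.
by rewrite lerDr.
Qed.

Lemma harmonic_large (M : R) :
  exists N, M < \sum_(1 <= n < N.+1) n%:R^-1.
Proof.
apply: contrapT => /forallNP h; apply: (@dvg_harmonic R).
apply: nondecreasing_is_cvgn.
  by apply: nondecreasing_series => n _; rewrite harmonic_ge0.
exists M => _ [N _ <-]; rewrite /series /=.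
have := h N; move/negP; rewrite -leNgt big_add1 /=.
by move=> /le_trans; apply.
Qed.

End BoundedSequences.

(** * Uniform boundedness on a closed subspace *)
Section UniformBoundedness.
Context {R : realType} {X : completeNormedModType R[i]}.
Variable Y : set X.
Hypotheses (Y0 : Y 0) (YP : forall a x y, Y x -> Y y -> Y (a *: x + y)).

(** If f is large at w, then after rescaling w to length r / 2 the values of f at
    x + w and x - w cannot both be small, their half-difference being f w; and f
    stays large near the better of the two. *)
Lemma escape_ball (f : {linear X -> X}) c x r k w :
  op_le f c -> 0 <= c -> Y x -> 0 < r -> 0 <= k ->
  Y w -> 2 * (k + 1) / r * rnorm w < rnorm (f w) ->
  exists x' r', [/\ Y x', 0 < r', r' <= r / 2, rnorm (x' - x) + r' <= r &
    forall z, rnorm (z - x') <= r' -> k <= rnorm (f z)].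
Proof.
move=> fc c0 Yx r0 k0 Yw hw.
have w0 : 0 < rnorm w.
  rewrite lt_neqAle rnorm_ge0 andbT eq_sym; apply/eqP => /rnorm_eq0 w0.
  by move: hw; rewrite w0 linear0 rnorm0 mulr0 ltxx.
pose a := r / 2 / rnorm w; pose v := a%:C *: w.
have a0 : 0 < a by rewrite !divr_gt0.
have rv : rnorm v = r / 2.
  by rewrite rnormZ rnorm_real gtr0_norm// mulfVK// gt_eqF.
have fv : k + 1 < rnorm (f v).
  rewrite linearZZ rnormZ rnorm_real gtr0_norm//.
  have -> : k + 1 = a * (2 * (k + 1) / r * rnorm w).
    by rewrite /a; field; rewrite !gt_eqF.
  by rewrite ltr_pM2l.
have [x' [Yx' dx fx]] :
    exists x', [/\ Y x', rnorm (x' - x) = r / 2 & k + 1 < rnorm (f x')].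
  have [h|h] := ltP (k + 1) (rnorm (f (v + x))).
    by exists (v + x); rewrite addrK; split=> //; exact: YP.
  exists (- v + x); rewrite addrK rnormN; split=> //.
    by rewrite /v -scaleNr; exact: YP.
  rewrite ltNge; apply/negP => h'; move: fv; rewrite ltNge => /negP; apply.
  rewrite linearD in h; apply: rnorm_le_of_addsub h _.
  by rewrite rnorm_sub -linearB addrC.
pose r' := Num.min (r / 2) (c + 1)^-1.
have c1 : 0 < c + 1 by lra.
exists x', r'; split=> //.
- by rewrite lt_min divr_gt0// invr_gt0.
- by rewrite ge_min lexx.
- by rewrite dx [leRHS](splitr r) lerD2l ge_min lexx.
- move=> z hz.
  have h1 : rnorm (f z - f x') <= 1.
    rewrite -linearB; apply: le_trans (fc _) _.
    have h2 : rnorm (z - x') <= (c + 1)^-1.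
      by apply: le_trans hz _; rewrite ge_min lexx orbT.
    apply: (le_trans (ler_wpM2l c0 h2)).
    by rewrite ler_pdivrMr// mul1r lerDl.
  have := ler_rnorm_sub (f x') (f z); rewrite rnorm_sub; lra.
Qed.

(** If the bounds were not uniform, [escape_ball] would give nested balls of radii
    tending to 0, on which some H n exceed arbitrarily large numbers; their common
    point, in Y because Y is closed, would be a point of unboundedness.  Keeping Y
    a subset lets the completeness of X serve for the limit. *)
Lemma uniform_boundedness (H : nat -> {linear X -> X}) :
  closed Y -> (forall n, exists2 c, 0 <= c & op_le (H n) c) ->
  (forall x, Y x -> exists b, forall n, rnorm (H n x) <= b) ->
  exists2 M, 0 <= M & forall n x, Y x -> rnorm (H n x) <= M * rnorm x.
Proof.
move=> cY hH hpt; apply: contrapT => hno.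
have unb M : 0 <= M -> exists n x, Y x /\ M * rnorm x < rnorm (H n x).
  move=> M0; apply: contrapT => h; apply: hno; exists M => // n x Yx.
  by rewrite leNgt; apply/negP => hlt; apply: h; exists n, x.
have step (q : nat * (X * R)) : exists q' : X * R,
    Y q.2.1 -> 0 < q.2.2 ->
    [/\ Y q'.1, 0 < q'.2, q'.2 <= q.2.2 / 2,
        rnorm (q'.1 - q.2.1) + q'.2 <= q.2.2 &
        exists n, forall z, rnorm (z - q'.1) <= q'.2 ->
          q.1%:R <= rnorm (H n z)].
  case: q => k [x r] /=.
  have [[Yx r0]|h] := pselect (Y x /\ 0 < r); last first.
    by exists (x, r) => Yx r0; case: h.
  have [|n [w [Yw hw]]] := unb (2 * (k%:R + 1) / r).
    by rewrite divr_ge0 ?ltW// mulr_gt0// ltr_wpDl.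
  have [c c0 hc] := hH n.
  have [x' [r' [h1 h2 h3 h4 h5]]] :=
    escape_ball (H n) c x r k%:R w hc c0 Yx r0 (ler0n _ _) Yw hw.
  by exists (x', r') => _ _; split=> //; exists n.
have [f hf] := choice step.
(* s n is the n-th closed ball, given by its center and radius. *)
pose s := fix s n : X * R := if n is m.+1 then f (m, s m) else (0, 1).
have sY n : Y (s n).1 /\ 0 < (s n).2.
  elim: n => [|n [IH1 IH2]]; first by split=> //=; exact: ltr01.
  by have [] := hf (n, s n) IH1 IH2.
have sr n : n.+1%:R * (s n).2 <= 1.
  elim: n => [|n IH]; first by rewrite mul1r.
  have [h1 h2] := sY n; have [_ _ h3 _ _] := hf (n, s n) h1 h2.
  apply: le_trans IH; apply: (@le_trans _ _ (n.+2%:R * ((s n).2 / 2))).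
    by rewrite ler_wpM2l.
  have n0 : 0 <= n%:R :> R by [].
  have := mulr_ge0 n0 (ltW h2); rewrite -[n.+2]addn2 -[n.+1]addn1 !natrD; lra.
have sd k p : rnorm ((s (k + p)%N).1 - (s k).1) + (s (k + p)%N).2 <= (s k).2.
  elim: p => [|p IH]; first by rewrite addn0 subrr rnorm0 add0r.
  have [h1 h2] := sY (k + p)%N.
  have [_ _ _ h3 _] := hf ((k + p)%N, s (k + p)%N) h1 h2.
  rewrite addnS /=.
  have := ler_rnormD ((f ((k + p)%N, s (k + p)%N)).1 - (s (k + p)%N).1)
            ((s (k + p)%N).1 - (s k).1).
  rewrite subrKA; rewrite /= in h3; lra.
have sd' k m : (k <= m)%N -> rnorm ((s m).1 - (s k).1) <= (s k).2.
  move=> /subnKC <-; have := sd k (m - k)%N.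
  by have [_ /ltW] := sY (k + (m - k))%N; lra.
have [|x cx] := rnorm_cauchy_cvg (fun n => (s n).1).
  move=> e e0; have [N hN] := nat_large e^-1; exists N => n m hn hm.
  apply: le_lt_trans (sd' _ _ hm) _.
  have := hN _ hn; rewrite -[e^-1]mul1r ltr_pdivrMr// => h.
  by rewrite -(@ltr_pM2l _ n.+1%:R)// (le_lt_trans (sr n)).
have Yx : Y x.
  apply: cY; apply/rnorm_closureP => e e0.
  have [N hN] := (rnorm_cvgP _ _).1 cx _ e0.
  exists (s N).1; first by have [] := sY N.
  by rewrite rnorm_sub; exact: hN.
have xs k : rnorm (x - (s k).1) <= (s k).2.
  apply: (rnorm_cvg_le _ _ _ _ k cx) => m; exact: sd'.
have [b hb] := hpt _ Yx; have [N hN] := nat_large b.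
have [h1 h2] := sY N.+1; have [_ _ _ _ [n hn]] := hf (N.+1, s N.+1) h1 h2.
have /= := hn x (xs N.+2).
by rewrite leNgt (le_lt_trans (hb n))// hN.
Qed.

End UniformBoundedness.

(** * The logarithmic series *)
Section LogSeries.
Context {R : realType} {X : completeNormedModType R[i]}.
Variables (T : {linear X -> X}) (t : R).
Hypotheses (t0 : 0 <= t) (Tt : op_le T t).

(** I - (qT)^n is a polynomial in T times I - qT. *)
Lemma power_defect_le (q : R[i]) n : exists2 c, 0 <= c &
  forall x, rnorm (x - q ^+ n *: iter n T x) <= c * rnorm (x - q *: T x).
Proof.
elim: n => [|n [c c0 IH]].
  by exists 0 => // x; rewrite expr0 scale1r subrr rnorm0 mul0r.
have qt0 : 0 <= rnorm q * t by rewrite mulr_ge0 ?rnorm_ge0.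
exists (1 + rnorm q * t * c); first by rewrite addr_ge0 ?mulr_ge0 ?rnorm_ge0.
move=> x.
have -> : x - q ^+ n.+1 *: iter n.+1 T x =
    (x - q *: T x) + q *: T (x - q ^+ n *: iter n T x).
  by rewrite (linearB T) (linearZZ T) scalerBr scalerA -exprS subrKA.
apply: le_trans (ler_rnormD _ _) _; rewrite mulrDl mul1r lerD2l rnormZ.
rewrite -!mulrA ler_wpM2l ?rnorm_ge0//.
apply: le_trans (Tt _) _; rewrite ler_wpM2l//; exact: IH.
Qed.

(** Partial sums of - log (I - uT). *)
Definition log_sum (u : R[i]) N (x : X) : X :=
  \sum_(1 <= n < N.+1) (u ^+ n / n%:R) *: iter n T x.

Lemma log_sumS u N x : log_sum u N.+1 x =
  log_sum u N x + (u ^+ N.+1 / N.+1%:R) *: iter N.+1 T x.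
Proof. by rewrite /log_sum big_nat_recr. Qed.

Lemma linear_log_sum u N : linear (log_sum u N).
Proof.
move=> a x y; rewrite /log_sum scaler_sumr -big_split; apply: eq_bigr => n _.
by rewrite linear_iter scalerDr !scalerA mulrC.
Qed.

Lemma log_sum_bounded u N : exists2 c, 0 <= c & op_le (log_sum u N) c.
Proof.
elim: N => [|N [c c0 IH]].
  by exists 0 => // x; rewrite /log_sum big_geq// rnorm0 mul0r.
exists (c + rnorm (u ^+ N.+1 / N.+1%:R) * t ^+ N.+1).
  by rewrite addr_ge0// mulr_ge0 ?rnorm_ge0 ?exprn_ge0.
move=> x; rewrite log_sumS.
exact: (op_leD _ _ _ _ IH (op_leZ _ _ _ (op_le_iter _ _ _ t0 Tt))).
Qed.

Lemma log_sum_defect u N : exists2 c, 0 <= c &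
  forall x, rnorm ((\sum_(1 <= n < N.+1) n%:R^-1)%:C *: x - log_sum u N x) <=
    c * rnorm (x - u *: T x).
Proof.
elim: N => [|N [c c0 IH]].
  exists 0 => // x; rewrite /log_sum !big_geq// scale0r subrr rnorm0.
  by rewrite mul0r.
have [d d0 hd] := power_defect_le u N.+1.
exists (c + N.+1%:R^-1 * d); first by rewrite addr_ge0// mulr_ge0.
move=> x; rewrite log_sumS big_nat_recr//= rmorphD /= scalerDl opprD addrACA.
rewrite mulrDl; apply: le_trans (ler_rnormD _ _) _; apply: lerD => //.
have -> : (N.+1%:R^-1 : R)%:C *: x - (u ^+ N.+1 / N.+1%:R) *: T (iter N T x) =
    N.+1%:R^-1 *: (x - u ^+ N.+1 *: iter N.+1 T x).
  by rewrite scalerBr scalerA [_ * u ^+ _]mulrC fmorphV rmorph_nat.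
by rewrite rnormZ rnormV rnorm_nat -mulrA ler_wpM2l ?invr_ge0.
Qed.

(** If uT x is close to x, then so is u^n T^n x for all n <= N, and the partial sum
    is close to the N-th harmonic number times x.  Choosing that number larger
    than M + 1 makes this incompatible with the bound M. *)
Lemma log_bounded_below (Y : set X) u M :
  (forall N x, Y x -> rnorm (log_sum u N x) <= M * rnorm x) ->
  exists c, bounded_below_on T Y u c.
Proof.
move=> hM; have [N hN] := harmonic_large (M + 1).
have [c c0 hc] := log_sum_defect u N; exists c => x Yx.
have h1 := hM N x Yx; have h2 := hc x.
set h := \sum_(_ <= n < _) _ in hN h2.
have := ler_rnorm_sub (h%:C *: x) (log_sum u N x).
rewrite rnormZ rnorm_real => h3.
have h4 : (M + 1) * rnorm x <= `|h| * rnorm x.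
  by rewrite ler_wpM2r ?rnorm_ge0// (le_trans (ltW hN))// ler_norm.
lra.
Qed.

End LogSeries.

(** * Norm convergence from decay on the range of I - T *)
Section ConvergenceFromDecay.
Context {R : realType} {X : completeNormedModType R[i]}.
Variables (T : {linear X -> X}) (t K : R) (Y : set X).
Hypotheses (t0 : 0 <= t) (Tt : op_le T t) (K0 : 0 <= K).
Hypothesis YB : forall p x, Y (x - iter p T x).
Hypothesis decay : forall n x, Y x ->
  n.+1%:R * rnorm (iter n T x) <= K * rnorm x.

Lemma iter_diff_le B n p x : op_le (iter p T) B ->
  n.+1%:R * rnorm (iter n T x - iter (n + p) T x) <= K * ((1 + B) * rnorm x).
Proof.
move=> hB; have := decay n _ (YB p x).
rewrite linear_iterB -iterD.
move=> /le_trans; apply; rewrite ler_wpM2l//.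
exact: (op_leB _ _ _ _ op_le_id hB).
Qed.

(** T^(M+q) differs from T^M by T^M (I - T^q), whose norm is at most half of
    1 + ||T^q|| once M is large; hence a bound for smaller powers propagates. *)
Lemma power_bounded : exists2 B, 0 <= B & forall p, op_le (iter p T) B.
Proof.
have [N hN] := nat_large (2 * K); pose M := N.+1.
have [b b0 hb] := bounded_initial (fun k => t ^+ k) M.
have tM : 0 <= t ^+ M by rewrite exprn_ge0.
(* For p = M + q the bound B on T^q gives
   ||T^p|| <= t^M + (1 + B) / 2, which is at most B because B >= 2 t^M + 1. *)
pose B := b + 2 * t ^+ M + 1.
have B0 : 0 <= B by rewrite !addr_ge0// mulr_ge0.
exists B => // p; elim/ltn_ind: p => p IH.
have [pM|Mp] := ltnP p M.
  apply: op_leW (op_le_iter _ _ p t0 Tt); apply: le_trans (hb _ pM) _.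
  by rewrite /B; lra.
move=> x; have pE : p = (M + (p - M))%N by rewrite subnKC.
have h1 := iter_diff_le B M (p - M) x (IH _ _).
have {}h1 : M.+1%:R * rnorm (iter M T x - iter p T x) <=
    K * ((1 + B) * rnorm x).
  by rewrite {1}pE; apply: h1; rewrite ltn_subrL /=; exact: leq_trans Mp.
have h2 := op_le_iter T t M t0 Tt x.
have h3 := ler_rnorm_sub (iter p T x) (iter M T x).
rewrite rnorm_sub in h3.
have h4 : 2 * K * rnorm (iter M T x - iter p T x) <=
    M.+1%:R * rnorm (iter M T x - iter p T x).
  by rewrite ler_wpM2r ?rnorm_ge0// ltW// hN.
have h5 : M.+1%:R * rnorm (iter M T x - iter p T x) <=
   M.+1%:R * (2^-1 * ((1 + B) * rnorm x)).
  apply: le_trans h1 _; rewrite mulrA ler_wpM2r//.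
    by apply: mulr_ge0; [exact: addr_ge0|exact: rnorm_ge0].
  have := hN M (leqnSn _); lra.
rewrite ler_pM2l ?ltr0Sn// in h5.
have : (2 * t ^+ M + 1) * rnorm x <= B * rnorm x.
  by rewrite ler_wpM2r ?rnorm_ge0// /B; lra.
lra.
Qed.

(** T^n - T^m = T^n (I - T^(m-n)) with I - T^(m-n) bounded independently of m. *)
Lemma op_cvg_of_decay : op_cvg (fun n => iter n T).
Proof.
have [B B0 hB] := power_bounded.
pose U n := linear_pack _ (linear_iter T n).
have hU n : exists c, op_le (U n) c by exists B; exact: hB.
apply/(op_cvgP U hU); have [|P [bP _ hP]] := cauchy_op_cvg U hU; last by exists P.
move=> e e0; have [N hN] := nat_large (K * (1 + B) / e); exists N => n m hn hm x.
have := iter_diff_le B n (m - n) x (hB _); rewrite subnKC// => h1.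
have h2 : K * (1 + B) * rnorm x <= n.+1%:R * e * rnorm x.
  by rewrite ler_wpM2r ?rnorm_ge0// -ler_pdivrMr// ltW// hN.
by rewrite rnorm_sub -(@ler_pM2l _ n.+1%:R)//; lra.
Qed.

End ConvergenceFromDecay.

(** * Norm convergence from the logarithmic series *)
Section FromLogSeries.
Context {R : realType} {X : completeNormedModType R[i]}.
Variables (T : {linear X -> X}) (t : R).
Hypotheses (t0 : 0 <= t) (Tt : op_le T t).

Lemma growth_of_opnorm :
  (n%:R^-1 * opnorm (iter n T) @[n --> \oo] --> (0 : R)) ->
  exists2 D, 0 <= D & forall n, op_le (iter n T) (D * n.+1%:R).
Proof.
move=> /cvgrPdist_le/(_ _ ltr01)[N _ hN].
have [|D D0 hD] := bounded_of_eventually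
    (fun n => opnorm (iter n T) / n.+1%:R) N.+1 1.
  move=> [//|n] hn; have := hN n.+1 (ltnW hn) => /=.
  rewrite sub0r normrN ger0_norm ?mulr_ge0 ?opnorm_ge0// mulrC.
  rewrite !ler_pdivrMr// !mul1r => /le_trans; apply.
  by rewrite ler_nat.
exists D => // n; apply: (@op_leW _ _ _ (opnorm (iter n T))).
  by rewrite -ler_pdivrMr.
exact: (le_opnorm (linear_pack _ (linear_iter T n)) _ (op_le_iter _ _ n t0 Tt)).
Qed.

Let Y := closure (range (fun y : X => y - T y)).

Lemma defect_closure_linear (a : R[i]) x y : Y x -> Y y -> Y (a *: x + y).
Proof.
move=> /rnorm_closureP hx /rnorm_closureP hy; apply/rnorm_closureP => e e0.
have a1 : 0 < rnorm a + 1 by rewrite ltr_wpDl ?rnorm_ge0.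
have [|_ [x' _ <-] hx'] := hx (e / 2 / (rnorm a + 1)); first by rewrite !divr_gt0.
have [|_ [y' _ <-] hy'] := hy (e / 2); first by rewrite divr_gt0.
exists ((a *: x' + y') - T (a *: x' + y')); first by exists (a *: x' + y').
have -> : a *: x + y - (a *: x' + y' - T (a *: x' + y')) =
   a *: (x - (x' - T x')) + (y - (y' - T y')).
  rewrite (linearP T) !scalerBr [RHS]addrACA -[in RHS]opprD.
  by congr (_ - _); rewrite opprD addrACA.
apply: le_lt_trans (ler_rnormD _ _) _; rewrite rnormZ.
rewrite ltr_pdivlMr// in hx'.
have := rnorm_ge0 (x - (x' - T x')); lra.
Qed.

Lemma defect_in_closure x : Y (x - T x).
Proof. by apply: subset_closure; exists x. Qed.

Lemma defect_closure0 : Y 0.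
Proof. by have := defect_in_closure 0; rewrite linear0 subr0. Qed.

Lemma defect_closureT x : Y x -> Y (T x).
Proof.
move=> /rnorm_closureP hx; apply/rnorm_closureP => e e0.
have t1 : 0 < t + 1 by rewrite ltr_wpDl.
have [|_ [y _ <-] hy] := hx (e / (t + 1)); first by rewrite divr_gt0.
exists (T y - T (T y)); first by exists (T y).
rewrite -!(linearB T); apply: le_lt_trans (Tt _) _.
by rewrite ltr_pdivlMr// in hy; have := rnorm_ge0 (x - (y - T y)); lra.
Qed.

Lemma defect_iter_in_closure p x : Y (x - iter p T x).
Proof.
elim: p => [|p IH]; first by rewrite subrr; exact: defect_closure0.
have -> : x - iter p.+1 T x = 1 *: (x - iter p T x) + (iter p T x - T (iter p T x)).
  by rewrite scale1r subrKA.
by apply: defect_closure_linear => //; exact: defect_in_closure.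
Qed.

Lemma op_cvg_of_log_series :
  (n%:R^-1 * opnorm (iter n T) @[n --> \oo] --> (0 : R)) ->
  (forall x, Y x -> forall u, unit_circle R u -> cvgn (fun N => log_sum T u N x)) ->
  op_cvg (fun n => iter n T).
Proof.
move=> /growth_of_opnorm[D D0 hD] hlog.
have [|K K0 hK] := power_decay T t Y t0 Tt defect_closure0
    defect_closure_linear defect_closureT D D0 hD.
  move=> u u1.
  have [|||M M0 hM] := uniform_boundedness Y defect_closure0 defect_closure_linear
      (fun N => linear_pack _ (linear_log_sum T u N)).
  - exact: closed_closure.
  - by move=> N; exact: (log_sum_bounded T t).
  - move=> x Yx.
    have /cvg_ex[l /rnorm_cvgP/(_ _ ltr01)[N hN]] :=
      hlog x Yx u ((rnorm_circle u).2 u1).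
    have [|b _ hb] := bounded_of_eventually
        (fun n => rnorm (log_sum T u n x)) N (1 + rnorm l).
      move=> n hn; have := hN n hn.
      by have := ler_rnorm_sub (log_sum T u n x) l; lra.
    by exists b; exact: hb.
  by apply: (log_bounded_below T t t0 Tt Y u M) => N x; exact: hM.
exact: (op_cvg_of_decay T t K Y t0 Tt K0 defect_iter_in_closure hK).
Qed.

End FromLogSeries.

(** * Neumann series and approximate inverses *)
Section Inverse.
Context {R : realType} {X : completeNormedModType R[i]}.

Lemma op_le_sum (f : nat -> X -> X) n :
  (forall k, exists2 c, 0 <= c & op_le (f k) c) ->
  exists2 c, 0 <= c & op_le (fun x => \sum_(k < n) f k x) c.
Proof.
move=> hf; elim: n => [|n [c c0 IH]].
  by exists 0 => // x; rewrite big_ord0 rnorm0 mul0r.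
have [d d0 hd] := hf n; exists (c + d); first exact: addr_ge0.
by move=> x; rewrite big_ord_recr; exact: (op_leD _ _ _ _ IH hd).
Qed.

Lemma op_le_cvg (f : {linear X -> X}) c (u : nat -> X) l :
  0 <= c -> op_le f c ->
  (u n @[n --> \oo] --> l) -> f (u n) @[n --> \oo] --> f l.
Proof.
move=> c0 hf /rnorm_cvgP h; apply/rnorm_cvgP => e e0.
have c1 : 0 < c + 1 by rewrite ltr_wpDl.
have [|N hN] := h (e / (c + 1)); first exact: divr_gt0.
exists N => n /hN; rewrite -linearB ltr_pdivlMr// => h1.
apply: le_lt_trans (hf _) _; have := rnorm_ge0 (u n - l); lra.
Qed.

Lemma op_lim_cvg (U : nat -> X -> X) (P : X -> X) :
  (forall e, 0 < e ->
    exists N, forall n, (N <= n)%N -> op_le (fun x => U n x - P x) e) ->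
  forall x, U n x @[n --> \oo] --> P x.
Proof.
move=> h x; apply/rnorm_cvgP => e e0.
have x1 : 0 < rnorm x + 1 by rewrite ltr_wpDl ?rnorm_ge0.
have [|N hN] := h (e / (rnorm x + 1)); first exact: divr_gt0.
exists N => n hn; apply: le_lt_trans (hN n hn x) _.
by rewrite mulrAC ltr_pdivrMr// ltr_pM2l// ltrDl.
Qed.

Lemma linear_sum_iter (E : {linear X -> X}) (w : nat -> R[i]) n :
  linear (fun x => \sum_(k < n) w k *: iter k E x).
Proof.
move=> a x y; rewrite scaler_sumr -big_split; apply: eq_bigr => k _.
by rewrite linear_iter scalerDr !scalerA mulrC.
Qed.

Lemma sum_iter_comm (E A : {linear X -> X}) (w : nat -> R[i]) n x :
  (forall y, E (A y) = A (E y)) ->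
  \sum_(k < n) w k *: iter k E (A x) = A (\sum_(k < n) w k *: iter k E x).
Proof.
move=> h; rewrite linear_sum; apply: eq_bigr => k _; rewrite (linearZZ A).
by congr (_ *: _); elim: (nat_of_ord k) => //= m ->.
Qed.

(** F is the operator limit of the sums of E^k for k < n; the two identities are
    limits of (I - E) sum_(k < n) E^k = I - E^n. *)
Lemma neumann (E : {linear X -> X}) : op_le E 2^-1 ->
  exists F : {linear X -> X}, [/\ bounded_op F,
    forall x, F (x - E x) = x & forall x, F x - E (F x) = x].
Proof.
move=> hE.
have hEk k : op_le (iter k E) (2^-1 ^+ k) by exact: op_le_iter.
pose U n := linear_pack _ (linear_sum_iter E (fun=> 1) n).
have UE n x : U n.+1 x = U n x + iter n E x.
  by rewrite /U /= big_ord_recr /= scale1r.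
have hU n : exists c, op_le (U n) c.
  have [k|c _ hc] := op_le_sum (fun k x => 1 *: iter k E x) n; last by exists c.
  exists (2^-1 ^+ k); first by rewrite exprn_ge0.
  by move=> x; rewrite scale1r; exact: hEk.
have hUd n p x : rnorm (U (n + p)%N x - U n x) <=
    (2 * 2^-1 ^+ n - 2 * 2^-1 ^+ (n + p)) * rnorm x.
  elim: p => [|p IH]; first by rewrite addn0 !subrr rnorm0 mul0r.
  rewrite addnS UE addrAC; apply: le_trans (ler_rnormD _ _) _.
  have := hEk (n + p)%N x; rewrite exprS; lra.
have small n : 2^-1 ^+ n <= 2 / n.+1%:R :> R.
  rewrite ler_pdivlMr// mulrC.
  have := @geometric_decay R 2^-1 n; have -> : (1 - 2^-1 : R)^-1 = 2 by field.
  by apply; lra.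
have [|F [bF cF _]] := cauchy_op_cvg U hU.
  move=> e e0; have [N hN] := nat_large (4 / e); exists N => n m hn hm x.
  have := hUd n (m - n)%N x; rewrite subnKC// => /le_trans; apply.
  rewrite ler_wpM2r ?rnorm_ge0//.
  have h0 : 0 <= 2^-1 ^+ m :> R by rewrite exprn_ge0.
  have : 4 / n.+1%:R <= e.
    by rewrite ler_pdivrMr// mulrC -ler_pdivrMr// ltW// hN.
  have := small n; move: h0; set a := _ ^+ m; set b := _ ^+ n.
  set v := n.+1%:R^-1; lra.
have hF x : F x - E (F x) = x.
  have c1 : (U n x - E (U n x)) @[n --> \oo] --> F x - E (F x).
    by apply: cvgB => //; apply: (op_le_cvg _ 2^-1) (cF x).
  apply: (rnorm_cvg_unique _ _ _ c1); apply/rnorm_cvgP => e e0.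
  have [N hN] := nat_large (2 * (rnorm x + 1) / e); exists N => n hn.
  have := geometric_telescope E 1 n x => /=.
  rewrite expr1n !scale1r => h.
  have -> : U n x - E (U n x) = x - iter n E x.
    by rewrite -h /U /=; congr (_ - E _); apply: eq_bigr => k _; rewrite expr1n.
  rewrite addrC addrA addNr sub0r rnormN; apply: le_lt_trans (hEk n x) _.
  have x0 := rnorm_ge0 x.
  apply: le_lt_trans (ler_wpM2r x0 (small n)) _.
  rewrite mulrAC ltr_pdivrMr//; have := hN n hn.
  rewrite ltr_pdivrMr// => h1; rewrite mulrC in h1; lra.
exists F; split=> // x; rewrite linearB.
suff -> : F (E x) = E (F x) by exact: hF.
apply: (rnorm_cvg_unique _ _ _ (cF _)).
under eq_fun => n do
  rewrite (sum_iter_comm E E (fun=> 1) n x (fun=> erefl) : U n (E x) = E (U n x)).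
by apply: (op_le_cvg _ 2^-1) (cF x).
Qed.

(** An inverse B of A up to a small error E is corrected by the Neumann series
    of E. *)
Lemma bounded_inverse (A B E : {linear X -> X}) :
  bounded_op B -> op_le E 2^-1 ->
  (forall x, A (B x) = x - E x) -> (forall x, B (A x) = x - E x) ->
  exists S : {linear X -> X}, [/\ bounded_op S, cancel A S & cancel S A].
Proof.
move=> /bounded_opP[b b0 hb] hE hAB hBA.
have [F [/bounded_opP[c c0 hc] hF1 hF2]] := neumann E hE.
have lin : linear (fun x => B (F x)) by move=> a x y; rewrite !linearP.
exists (linear_pack _ lin); split.
- apply/bounded_opP; exists (b * c); first exact: mulr_ge0.
  exact: op_le_comp.
- move=> x /=.
  (* F B is a left inverse of A and B F a right inverse, hence they agree. *)
  have FB y : F (B y) = B (F y).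
    by rewrite -[in LHS](hF2 y) -hAB hBA hF1.
  by rewrite -FB hBA hF1.
- by move=> x /=; rewrite hAB hF2.
Qed.

End Inverse.

(** * The spectrum of an operator with convergent powers *)
Section PowerConvergence.
Context {R : realType} {X : completeNormedModType R[i]}.
Variables (T P : {linear X -> X}) (t d : R).
Hypotheses (t0 : 0 <= t) (Tt : op_le T t) (d0 : 0 <= d) (Pd : op_le P d).
Hypothesis TP : forall e, 0 < e ->
  exists N, forall n, (N <= n)%N -> op_le (fun x => iter n T x - P x) e.

Lemma power_cvg x : iter n T x @[n --> \oo] --> P x.
Proof. exact: op_lim_cvg TP x. Qed.

Lemma power_cvgS x : iter n.+1 T x @[n --> \oo] --> P x.
Proof. by have := power_cvg x; rewrite -(cvg_shiftS (fun n => iter n T x)). Qed.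

Lemma limit_fixed x : T (P x) = P x.
Proof.
exact: rnorm_cvg_unique (op_le_cvg _ _ _ _ t0 Tt (power_cvg x)) (power_cvgS x).
Qed.

Lemma limit_invariant x : P (T x) = P x.
Proof.
apply: rnorm_cvg_unique (power_cvg (T x)) _.
by under eq_fun do rewrite -iterSr; exact: power_cvgS.
Qed.

Lemma iter_limit n x : iter n T (P x) = P x.
Proof. by elim: n => //= n ->; exact: limit_fixed. Qed.

(** On the range of P, where T acts as the identity, l - T is inverted by
    1 / (l - 1); on the range of I - P, where T^n tends to 0, the geometric series
    for (l - T)^-1 is cut at N with error l^(-N) (T^N - P). *)
Lemma power_limit_spectrum : spectrum T `&` unit_circle R `<=` [set 1].
Proof.
move=> l [/= hl /rnorm_circle l1]; apply: contrapT => /= ln1; apply: hl.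
have l0 : l != 0.
  by apply/eqP => l0; move: l1; rewrite l0 rnorm0 => /eqP; rewrite eq_sym oner_eq0.
have [|N hN] := TP 2^-1; first by rewrite invr_gt0.
pose q := l^-1.
have q1 : rnorm q = 1 by rewrite rnormV l1 invr1.
pose b (x : X) := q *: (\sum_(k < N) q ^+ k *: iter k T (x - P x))
                  + (l - 1)^-1 *: P x.
have linb : linear b.
  move=> a x y; rewrite /b (linearP P).
  have -> : a *: x + y - (a *: P x + P y) = a *: (x - P x) + (y - P y).
    by rewrite scalerBr opprD addrACA.
  rewrite (linear_sum_iter T (fun k => q ^+ k)) !scalerDr !scalerA.
  by rewrite ![_ * a]mulrC addrACA.
have line : linear (fun x => q ^+ N *: (iter N T x - P x)).
  move=> a x y; rewrite (linearP P) linear_iter opprD addrACA -scalerBr.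
  by rewrite scalerDr !scalerA mulrC.
have lina : linear (fun x => l *: x - T x).
  move=> a x y; rewrite (linearP T) opprD scalerDr addrACA.
  by rewrite scalerBr !scalerA mulrC.
have main x : l *: b x - T (b x) = x - q ^+ N *: (iter N T x - P x).
  have := geometric_telescope T q N (x - P x) => /=.
  rewrite linear_iterB iter_limit /b.
  set G := \sum_(_ < _) _ => hG.
  rewrite (linearD T) !(linearZZ T) limit_fixed scalerDr opprD addrACA.
  rewrite [l *: (q *: G)]scalerA mulfV// scale1r hG scalerA -scalerBl.
  have -> : l / (l - 1) - (l - 1)^-1 = 1.
    by field; rewrite subr_eq0; apply/eqP.
  by rewrite scale1r addrAC subrK.
have commb x : b (T x) = T (b x).
  rewrite /b limit_invariant (linearD T) !(linearZZ T) limit_fixed.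
  by rewrite -(sum_iter_comm T T (fun k => q ^+ k))// (linearB T) limit_fixed.
apply: (bounded_inverse (linear_pack _ lina) (linear_pack _ linb)
          (linear_pack _ line)) => /=.
- apply/bounded_opP.
  have [k|c c0 hc] := op_le_sum (fun k x => q ^+ k *: iter k T x) N.
    exists (rnorm (q ^+ k) * t ^+ k).
      by rewrite mulr_ge0 ?rnorm_ge0 ?exprn_ge0.
    exact: (op_leZ _ _ _ (op_le_iter _ _ _ t0 Tt)).
  have h1 := op_le_comp _ _ _ _ c0 hc (op_leB _ _ _ _ op_le_id Pd).
  exists (rnorm q * (c * (1 + d)) + rnorm (l - 1)^-1 * d).
    by rewrite addr_ge0 ?mulr_ge0 ?rnorm_ge0 ?addr_ge0.
  exact: op_leD _ _ _ _ (op_leZ q _ _ h1) (op_leZ (l - 1)^-1 _ _ Pd).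
- by move=> x; rewrite rnormZ rnormX q1 expr1n mul1r; exact: hN.
- exact: main.
- move=> x; rewrite -main -commb.
  exact: etrans (linearB (linear_pack _ linb) _ _)
    (congr1 (fun z => z - b (T x)) (linearZZ (linear_pack _ linb) l x)).
Qed.

End PowerConvergence.

(** * Cesaro means *)
Section Cesaro.
Context {R : realType} {X : completeNormedModType R[i]}.

Definition power_sum (S : X -> X) n (x : X) : X :=
  \sum_(1 <= k < n.+1) iter k S x.

Definition cesaro_mean (S : X -> X) n (x : X) : X := n%:R^-1 *: power_sum S n x.

Lemma power_sum0 S x : power_sum S 0 x = 0.
Proof. by rewrite /power_sum big_geq. Qed.

Lemma power_sumS S n x :
  power_sum S n.+1 x = power_sum S n x + iter n.+1 S x.
Proof. by rewrite /power_sum big_nat_recr. Qed.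

Lemma natC_neq0 n : n.+1%:R != 0 :> R[i].
Proof. by rewrite pnatr_eq0. Qed.

Lemma scale_cesaro_mean S n x : n.+1%:R *: cesaro_mean S n.+1 x = power_sum S n.+1 x.
Proof. by rewrite /cesaro_mean scalerA mulfV ?natC_neq0// scale1r. Qed.

Lemma rnormZ_nat n (x : X) : rnorm (n%:R *: x) = n%:R * rnorm x.
Proof. by rewrite rnormZ rnorm_nat. Qed.

Lemma cesaro_mean_le S n x c :
  rnorm (power_sum S n.+1 x) <= n.+1%:R * c -> rnorm (cesaro_mean S n.+1 x) <= c.
Proof.
by rewrite -scale_cesaro_mean rnormZ_nat ler_pM2l.
Qed.

Section Linear.
Context (T : {linear X -> X}) (t : R).
Hypotheses (t0 : 0 <= t) (Tt : op_le T t).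

Lemma linear_power_sum n : linear (power_sum T n).
Proof.
move=> a x y; rewrite /power_sum scaler_sumr -big_split.
by apply: eq_bigr => k _; rewrite linear_iter.
Qed.

Lemma linear_cesaro_mean n : linear (cesaro_mean T n).
Proof.
by move=> a x y; rewrite /cesaro_mean linear_power_sum scalerDr !scalerA mulrC.
Qed.

Lemma power_sum_bounded n : exists2 c, 0 <= c & op_le (power_sum T n) c.
Proof.
elim: n => [|n [c c0 IH]].
  by exists 0 => // x; rewrite power_sum0 rnorm0 mul0r.
exists (c + t ^+ n.+1); first by rewrite addr_ge0 ?exprn_ge0.
by move=> x; rewrite power_sumS; exact: (op_leD _ _ _ _ IH (op_le_iter _ _ _ t0 Tt)).
Qed.

Lemma uniformly_ergodicP : uniformly_ergodic T <->
  exists P : {linear X -> X}, bounded_op P /\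
    forall e, 0 < e ->
      exists N, forall n, (N <= n)%N -> op_le (fun x => cesaro_mean T n x - P x) e.
Proof.
apply: (op_cvgP (fun n => linear_pack _ (linear_cesaro_mean n))) => n.
have [c c0 hc] := power_sum_bounded n.
exists (rnorm (n%:R^-1 : R[i]) * c); exact: op_leZ.
Qed.

(** The image of I - T under the power sums stays bounded by the growth of the
    powers: this is what makes the means small on the range of I - T. *)
Lemma power_sum_telescope n x : power_sum T n (x - T x) = T x - iter n.+1 T x.
Proof.
elim: n => [|n IH]; first by rewrite power_sum0 subrr.
by rewrite power_sumS IH linear_iterB -iterSr subrKA.
Qed.

(** I - A_n is a polynomial in T times I - T; the factor 1 in front of T matches
    the rotation at u = 1. *)
Lemma power_sum_defect n : exists2 c, 0 <= c &
  forall x, rnorm (n%:R *: x - power_sum T n x) <= c * rnorm (x - 1 *: T x).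
Proof.
elim: n => [|n [c c0 IH]].
  by exists 0 => // x; rewrite power_sum0 scale0r subrr rnorm0 mul0r.
have [d d0 hd] := power_defect_le T t t0 Tt 1 n.+1.
exists (c + d); first exact: addr_ge0.
move=> x; rewrite power_sumS -natr1 scalerDl scale1r opprD addrACA mulrDl.
apply: le_trans (ler_rnormD _ _) _; apply: lerD => //.
by have := hd x; rewrite expr1n !scale1r.
Qed.

(** The first N terms contribute a fixed constant to the sum of T^k - P, the others
    at most e / 2 each. *)
Lemma ergodic_of_power_cvg (P : {linear X -> X}) :
  bounded_op P ->
  (forall e, 0 < e ->
    exists N, forall n, (N <= n)%N -> op_le (fun x => iter n T x - P x) e) ->
  uniformly_ergodic T.
Proof.
move=> bP hP; apply/uniformly_ergodicP; exists P; split=> // e e0.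
have [|N hN] := hP (e / 2); first by rewrite divr_gt0.
have [c c0 hc] : exists2 c, 0 <= c &
    op_le (fun x => power_sum T N x - N%:R *: P x) c.
  have [c c0 hc] := power_sum_bounded N; have /bounded_opP[d d0 hd] := bP.
  exists (c + rnorm (N%:R : R[i]) * d).
    by rewrite addr_ge0// mulr_ge0// rnorm_ge0.
  exact: op_leB _ _ _ _ hc (op_leZ _ _ _ hd).
have key p : op_le (fun x => power_sum T (N + p) x - (N + p)%:R *: P x)
    (c + p%:R * (e / 2)).
  elim: p => [|p IH]; first by rewrite addn0 mul0r addr0.
  move=> x; rewrite addnS power_sumS -natr1 scalerDl scale1r opprD addrACA.
  apply: le_trans (ler_rnormD _ _) _; have h1 := IH x.
  have := hN (N + p).+1 _ x; rewrite leqW ?leq_addr// => /(_ isT) h2.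
  by rewrite -natr1; lra.
have [M hM] := nat_large (2 * c / e).
exists (maxn N M).+1 => -[//|n]; rewrite ltnS geq_max => /andP[Nn Mn] x.
have := key (n.+1 - N)%N x; rewrite subnKC ?leqW// => h.
rewrite -(@ler_pM2l _ n.+1%:R)// -rnormZ_nat scalerBr scale_cesaro_mean.
apply: le_trans h _; rewrite [leRHS]mulrA ler_wpM2r ?rnorm_ge0//.
have h1 : (n.+1 - N)%:R * (e / 2) <= n.+1%:R * (e / 2).
  by rewrite ler_wpM2r ?ler_nat ?leq_subr// divr_ge0// ltW.
have := hM n Mn; rewrite ltr_pdivrMr//; lra.
Qed.

Definition sublinear_growth := forall e, 0 < e ->
  exists N, forall n, (N <= n)%N -> op_le (iter n T) (e * n%:R).

Lemma opnorm_sublinear_growth : sublinear_growth ->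
  (n%:R^-1 * opnorm (iter n T) @[n --> \oo] --> (0 : R)).
Proof.
move=> h; apply/cvgrPdist_le => e e0; have [N hN] := h _ e0.
exists N.+1 => // -[//|n] /= hn.
rewrite sub0r normrN ger0_norm ?mulr_ge0 ?opnorm_ge0// mulrC ler_pdivrMr//.
by apply: opnorm_le; [rewrite mulr_ge0// ltW|exact: hN (ltnW hn)].
Qed.

Section Ergodic.
Variables (P : {linear X -> X}) (d : R).
Hypotheses (d0 : 0 <= d) (Pd : op_le P d).
Hypothesis AP : forall e, 0 < e ->
  exists N, forall n, (N <= n)%N -> op_le (fun x => cesaro_mean T n x - P x) e.

(** T^n is the difference n A_n - (n-1) A_(n-1), and both means are close to P. *)
Lemma ergodic_growth : sublinear_growth.
Proof.
move=> e e0; have [|N hN] := AP (e / 4); first by rewrite divr_gt0.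
have [M hM] := nat_large (2 * d / e).
exists (maxn N M).+2 => -[//|[//|n]]; rewrite !ltnS geq_max => /andP[Nn Mn] x.
(* n A_n is the n-th power sum, so T^n is recovered as a difference of two
   consecutive ones; subtracting P from the means leaves one copy of P. *)
have hT : iter n.+2 T x = n.+2%:R *: (cesaro_mean T n.+2 x - P x)
    - n.+1%:R *: (cesaro_mean T n.+1 x - P x) + P x.
  rewrite !scalerBr !scale_cesaro_mean power_sumS -[X in X%:R *: P x]addn1 natrD.
  rewrite [(_ + 1%:R) *: _]scalerDl scale1r opprD addrACA.
  by rewrite [X in _ = X - _ + _]addrC addrK subrK.
rewrite hT; apply: le_trans (ler_rnormD _ _) _.
have h1 := ler_rnormB (n.+2%:R *: (cesaro_mean T n.+2 x - P x))
  (n.+1%:R *: (cesaro_mean T n.+1 x - P x)).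
rewrite !rnormZ_nat in h1.
have h2 : n.+2%:R * rnorm (cesaro_mean T n.+2 x - P x) <=
    n.+2%:R * (e / 4 * rnorm x).
  by rewrite ler_wpM2l//; apply: hN; rewrite !leqW.
have h3 : n.+1%:R * rnorm (cesaro_mean T n.+1 x - P x) <=
    n.+2%:R * (e / 4 * rnorm x).
  apply: ler_pM; rewrite ?rnorm_ge0 ?ler_nat//.
  by apply: hN; rewrite leqW.
have h4 : 2 * d * rnorm x <= e * n.+2%:R * rnorm x.
  rewrite ler_wpM2r ?rnorm_ge0// [leRHS]mulrC.
  by have := hM n.+1 (leqW Mn); rewrite ltr_pdivrMr// => /ltW.
have := Pd x; lra.
Qed.

(** A_n (T x) - A_n x = (T^(n+1) x - T x) / n tends to 0 by [ergodic_growth]. *)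
Lemma ergodic_invariant x : P (T x) = P x.
Proof.
apply/eqP; rewrite -subr_eq0; apply/eqP.
have c1 : cesaro_mean T n (T x) - cesaro_mean T n x @[n --> \oo] --> P (T x) - P x.
  by apply: cvgB; exact: (op_lim_cvg _ _ AP).
apply: (rnorm_cvg_unique _ _ _ c1); apply/rnorm_cvgP => e e0.
have x1 : 0 < rnorm x + 1 by rewrite ltr_wpDl ?rnorm_ge0.
have [|N hN] := ergodic_growth (e / 4 / (rnorm x + 1)); first by rewrite !divr_gt0.
have [M hM] := nat_large (4 * (t * rnorm x) / e).
exists (maxn N M).+1 => -[//|n]; rewrite ltnS geq_max => /andP[Nn Mn].
rewrite subr0 -(@ltr_pM2l _ n.+1%:R)// -rnormZ_nat scalerBr !scale_cesaro_mean.
have -> : power_sum T n.+1 (T x) - power_sum T n.+1 x = iter n.+2 T x - T x.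
  have SB : power_sum T n.+1 (x - T x) =
      power_sum T n.+1 x - power_sum T n.+1 (T x).
    exact: (linearB (linear_pack _ (linear_power_sum n.+1))).
  by rewrite -[LHS]opprB -SB power_sum_telescope opprB.
apply: le_lt_trans (ler_rnormB _ _) _.
have h1 := hN n.+2 _ x; rewrite !leqW// in h1; have {}h1 := h1 isT.
have h2 : e / 4 / (rnorm x + 1) * n.+2%:R * rnorm x <= e / 4 * n.+2%:R.
  rewrite mulrAC; rewrite ler_wpM2r// mulrAC ler_pdivrMr//.
  by rewrite ler_wpM2l ?divr_ge0 ?ltW// ltrDl.
have := hM n Mn; rewrite ltr_pdivrMr// => h3.
have h4 := Tt x.
have n0 : 0 <= e * n%:R by rewrite mulr_ge0// ltW.
have e2 : n.+2%:R = n%:R + 2 :> R by rewrite -addn2 natrD.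
have e1 : n.+1%:R = n%:R + 1 :> R by rewrite natr1.
rewrite e2 in h1 h2; rewrite e1 in h3 *; lra.
Qed.

End Ergodic.
End Linear.
End Cesaro.

(** * Ergodic operators with peripheral spectrum at most 1 *)
Section PeripheralSpectrum.
Context {R : realType} {X : completeNormedModType R[i]}.
Variables (T : {linear X -> X}) (t : R).
Hypotheses (t0 : 0 <= t) (Tt : op_le T t).
Hypothesis sT : spectrum T `&` unit_circle R `<=` [set 1].

(** I - uT = u (1/u - T), and 1/u lies on the circle, away from 1. *)
Lemma rotated_inverse u : rnorm u = 1 -> u != 1 ->
  exists (S : X -> X) (c : R), [/\ 0 <= c, op_le S c,
    forall x, S (x - u *: T x) = x & forall x, S x - u *: T (S x) = x].
Proof.
move=> u1 un1.
have u0 : u != 0.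
  by apply/eqP => u0; move: u1; rewrite u0 rnorm0 => /eqP; rewrite eq_sym oner_eq0.
have [S [/bounded_opP[c c0 hc] h1 h2]] : exists S : {linear X -> X},
    [/\ bounded_op S, cancel (fun x => u^-1 *: x - T x) S &
     cancel S (fun x => u^-1 *: x - T x)].
  apply: contrapT => h; have /= u1' := sT u^-1 (conj h _).
  move/eqP: un1; apply; rewrite -[u]invrK u1' ?invr1//.
  by apply/rnorm_circle; rewrite rnormV u1 invr1.
exists (fun x => u^-1 *: S x), (rnorm u^-1 * c); split.
- by rewrite mulr_ge0 ?rnorm_ge0.
- exact: op_leZ.
- move=> x; rewrite -(linearZZ S) scalerBr scalerA mulVf// scale1r.
  exact: h1.
- by move=> x; rewrite (linearZZ T) scalerA mulfV// scale1r; exact: h2.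
Qed.

Lemma rotated_bounded_below (Y : set X) u : rnorm u = 1 -> u != 1 ->
  exists c, bounded_below_on T Y u c.
Proof.
move=> u1 un1; have [S [c [_ hc h _]]] := rotated_inverse u u1 un1.
by exists c => x _; rewrite -{1}(h x); exact: hc.
Qed.

(** Every x is (I - uT) y with ||y|| <= c ||x||, so that the power sums of uT at x
    telescope and the means tend to 0 like ||T^n|| / n. *)
Lemma rotated_ergodic u : sublinear_growth T -> rnorm u = 1 -> u != 1 ->
  uniformly_ergodic (fun x => u *: T x).
Proof.
move=> hg u1 un1; have [S [c [c0 hc _ hS]]] := rotated_inverse u u1 un1.
have linV : linear (fun x => u *: T x).
  by move=> a x y; rewrite linearP scalerDr !scalerA mulrC.
pose V := linear_pack _ linV.
have Vt : op_le V t by move=> x; rewrite rnormZ u1 mul1r.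
have VT n x : rnorm (iter n V x) = rnorm (iter n T x).
  have -> : iter n V x = u ^+ n *: iter n T x.
    elim: n => [|n IH]; first by rewrite scale1r.
    by rewrite iterS IH /= (linearZZ T) scalerA exprS.
  by rewrite rnormZ rnormX u1 expr1n mul1r.
apply/(uniformly_ergodicP V t t0 Vt).
have lin0 : linear (fun _ : X => 0 : X) by move=> a x y; rewrite scaler0 addr0.
exists (linear_pack _ lin0); split.
  by apply/bounded_opP; exists 0 => // x; rewrite rnorm0 mul0r.
move=> e e0; pose e' := e / 4 / (c + 1).
have c1 : 0 < c + 1 by rewrite ltr_wpDl.
have [|N hN] := hg e'; first by rewrite !divr_gt0.
have [M hM] := nat_large (2 * (t * c) / e).
exists (maxn N M).+1 => -[//|n]; rewrite ltnS geq_max => /andP[Nn Mn] x /=.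
rewrite subr0; apply: cesaro_mean_le; rewrite -[in leLHS](hS x).
rewrite (power_sum_telescope V n.+1 (S x)).
apply: le_trans (ler_rnormB _ _) _; rewrite [rnorm (iter _ _ _)]VT.
have h1 := hN n.+2 (leqW (leqW Nn)) (S x).
have h2 := Vt (S x); have h3 := hc x.
have h4 := ler_wpM2l t0 h3.
have x0 := rnorm_ge0 x.
have e'0 : 0 <= e' by rewrite !divr_ge0// ltW.
have e'2 : 0 <= e' * n.+2%:R by rewrite mulr_ge0.
have h5 := ler_wpM2l e'2 h3.
have h6 : e' * c <= e / 4.
  by rewrite /e' mulrAC ler_pdivrMr// ler_wpM2l ?divr_ge0 ?lerDl// ltW.
have h7 : e' * c * (n.+2%:R * rnorm x) <= e / 4 * (n.+2%:R * rnorm x).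
  by rewrite ler_wpM2r// mulr_ge0.
have h8 : 2 * (t * c) * rnorm x <= n.+1%:R * e * rnorm x.
  by rewrite ler_wpM2r// -ler_pdivrMr// ltW// hM.
have e2 : n.+2%:R = n%:R + 2 :> R by rewrite -addn2 natrD.
have e1 : n.+1%:R = n%:R + 1 :> R by rewrite natr1.
have p0 : 0 <= e * n%:R * rnorm x by rewrite !mulr_ge0// ltW.
rewrite e2 in h1 h5 h7; rewrite e1 in h8 *; lra.
Qed.

Section Ergodic.
Variables (P : {linear X -> X}) (d : R).
Hypotheses (d0 : 0 <= d) (Pd : op_le P d).
Hypothesis AP : forall e, 0 < e ->
  exists N, forall n, (N <= n)%N -> op_le (fun x => cesaro_mean T n x - P x) e.

(** For n large A_n is at most 1/2 in norm on the kernel of P, so that I - A_n is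
    bounded below there; and I - A_n factors through I - T. *)
Lemma kernel_bounded_below :
  exists c, bounded_below_on T [set x | P x = 0] 1 c.
Proof.
have [|N hN] := AP 2^-1; first by rewrite invr_gt0.
have [c c0 hc] := power_sum_defect T t t0 Tt N.+1.
exists (2 * c) => x /= Px.
have h1 := hN N.+1 (leqnSn N) x; rewrite Px subr0 in h1.
have h2 := hc x; rewrite -scale_cesaro_mean -scalerBr rnormZ_nat in h2.
have h3 := ler_rnorm_sub x (cesaro_mean T N.+1 x).
have h4 : 1 * rnorm (x - cesaro_mean T N.+1 x) <=
    N.+1%:R * rnorm (x - cesaro_mean T N.+1 x).
  by rewrite ler_wpM2r ?rnorm_ge0// (ler_nat _ 1).
lra.
Qed.

Lemma kernel_decay : exists2 K, 0 <= K & forall n x, P x = 0 ->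
  n.+1%:R * rnorm (iter n T x) <= K * rnorm x.
Proof.
have hg := ergodic_growth T P d Pd AP.
have [D D0 hD] := growth_of_opnorm T t t0 Tt (opnorm_sublinear_growth T hg).
apply: (power_decay T t [set x | P x = 0] t0 Tt _ _ _ D D0 hD) => /=.
- exact: linear0.
- by move=> a x y Px Py; rewrite linearP Px Py scaler0 addr0.
- by move=> x Px; rewrite (ergodic_invariant T t Tt P d Pd AP).
- move=> u u1; have [->|un1] := eqVneq u 1; first exact: kernel_bounded_below.
  exact: rotated_bounded_below.
Qed.

Lemma defect_closure_kernel x :
  closure (range (fun y : X => y - T y)) x -> P x = 0.
Proof.
move=> /rnorm_closureP hx; apply: rnorm_eq0; apply/eqP.
rewrite eq_le rnorm_ge0 andbT; apply/ler_addgt0Pr => e e0; rewrite add0r.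
have d1 : 0 < d + 1 by rewrite ltr_wpDl.
have [|_ [y _ <-] hy] := hx (e / (d + 1)); first exact: divr_gt0.
have -> : P x = P (x - (y - T y)).
  by rewrite !(linearB P) (ergodic_invariant T t Tt P d Pd AP) subrr subr0.
rewrite ltr_pdivlMr// in hy.
have := Pd (x - (y - T y)); have := rnorm_ge0 (x - (y - T y)); lra.
Qed.

(** Absolute convergence: [kernel_decay] bounds the n-th term by
    K ||x|| / (n (n+1)). *)
Lemma log_series_cvg (u : R[i]) x : rnorm u = 1 -> P x = 0 ->
  cvgn (fun N => log_sum T u N x).
Proof.
move=> u1 Px; have [K K0 hK] := kernel_decay.
pose C := K * rnorm x; have C0 : 0 <= C by rewrite mulr_ge0 ?rnorm_ge0.
(* C / (n (n+1)) dominates the n-th term and telescopes. *)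
have step n p : rnorm (log_sum T u (n + p) x - log_sum T u n x) <=
    C / n.+1%:R - C / (n + p).+1%:R.
  elim: p => [|p IH]; first by rewrite addn0 !subrr rnorm0.
  rewrite addnS log_sumS addrAC; apply: le_trans (ler_rnormD _ _) _.
  set m := (n + p)%N in IH *.
  have h : rnorm ((u ^+ m.+1 / m.+1%:R) *: iter m.+1 T x) <=
      C / m.+1%:R - C / m.+2%:R.
    rewrite rnormZ rnormM rnormX u1 expr1n mul1r rnormV rnorm_nat.
    have -> : C / m.+1%:R - C / m.+2%:R = m.+1%:R^-1 * (C / m.+2%:R).
      have m1 : 1 + m%:R != 0 :> R by rewrite addrC natr1 pnatr_eq0.
      have m2 : 2 + m%:R != 0 :> R by rewrite -(natrD _ 2) pnatr_eq0.
      by field; rewrite m1 m2.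
    rewrite ler_wpM2l ?invr_ge0// ler_pdivlMr// mulrC.
    exact: hK.
  by apply: le_trans (lerD IH h) _; rewrite addrA subrK.
apply/cvg_ex; apply: rnorm_cauchy_cvg => e e0.
have [N hN] := nat_large (C / e); exists N => n m hn hm.
have := step n (m - n)%N; rewrite subnKC// => h; apply: le_lt_trans h _.
have : C / n.+1%:R < e by rewrite ltr_pdivrMr// mulrC -ltr_pdivrMr// hN.
have : 0 <= C / m.+1%:R by rewrite divr_ge0.
set a := C / _; set b := C / _; lra.
Qed.

End Ergodic.
End PeripheralSpectrum.

Theorem theorem4p4 (R : realType) (X : completeNormedModType R[i])
    (T : {linear X -> X}) (hT : bounded_op T) :
  [<-> (* (i) *)
       op_cvg (fun n : nat => iter n T);
       (* (ii) *)
       uniformly_ergodic T /\ spectrum T `&` unit_circle R `<=` [set 1];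
       (* (iii) *)
       rotationally_uniformly_ergodic T /\
         spectrum T `&` unit_circle R `<=` [set 1];
       (* (iv) *)
       (n%:R^-1 * opnorm (iter n T) @[n --> \oo] --> (0 : R)) /\
       forall x : X, closure (range (fun y : X => y - T y)) x ->
         forall l : R[i], unit_circle R l ->
           cvgn (fun N : nat =>
             \sum_(1 <= n < N.+1) (l ^+ n / n%:R) *: iter n T x)].
Proof.
have /bounded_opP[t t0 Tt] := hT.
split; [|split; [|split]].
- have hU n : exists c, op_le (linear_pack _ (linear_iter T n)) c.
    by exists (t ^+ n); exact: op_le_iter.
  move=> /(op_cvgP _ hU)[P [bP hP]].
  have /bounded_opP[d d0 Pd] := bP.
  split; first exact: ergodic_of_power_cvg t0 Tt P bP hP.
  exact: power_limit_spectrum t0 Tt d0 Pd hP.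
- move=> [/(uniformly_ergodicP T t t0 Tt)[P [/bounded_opP[d d0 Pd] AP]] sT].
  split=> // l /rnorm_circle l1; have [->|ln1] := eqVneq l 1.
    have -> : (fun x => 1 *: T x) = T by apply/funext => x; rewrite scale1r.
    by apply/(uniformly_ergodicP T t t0 Tt); exists P; split=> //;
      apply/bounded_opP; exists d.
  apply: (rotated_ergodic T t t0 Tt sT) => //.
  exact: (ergodic_growth T P d Pd AP).
- move=> [hrot sT].
  have := hrot 1 _; have -> : (fun x => 1 *: T x) = T.
    by apply/funext => x; rewrite scale1r.
  move=> /(_ _)/(uniformly_ergodicP T t t0 Tt)[|P [/bounded_opP[d d0 Pd] AP]].
    by apply/rnorm_circle; rewrite (rnorm_real 1) normr1.
  split; first exact: opnorm_sublinear_growth (ergodic_growth T P d Pd AP).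
  move=> x hx l /rnorm_circle l1.
  apply: (log_series_cvg T t t0 Tt sT P d Pd AP) => //.
  exact: (defect_closure_kernel T t Tt P d d0 Pd AP).
- move=> [hg hlog]; exact: (op_cvg_of_log_series T t t0 Tt hg hlog).
Qed.
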